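(* Let $(X,\mathbf R)$ be a symmetric association scheme with $D\ge3$ classes which is metric with respect to $A_0,\dots,A_D$ and cometric with respect to $E_0,\dots,E_D$, and which is not an ordinary cycle. Let $Y\subseteq X$ with $1<|Y|<|X|$ and set $\delta^*=\delta^*(Y)$. Let $0\le t\le D$ and suppose that $A_\ell\chi_Y$ is a relative $t$-codesign with respect to $x$ for every $0\le\ell\le D$ and every $x\in Y$. Suppose further that for every $x\in Y$, each irreducible $T(x)$-module $W\subseteq V$ with $1\le r^*(W)\le\delta^*$ satisfies $r(W)\le r^*(W)$. Then one of the following holds: (i) $(X,R_1)$ is bipartite and $Y$ is one of its two bipartite halves (colour classes); (ii) $(X,\mathbf R)$ is an antipodal double cover and $Y=\{x,y\}$ is an antipodal pair, i.e. $(x,y)\in R_D$; (iii) $\delta^*\ge t+1$.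
   Context: $(X,\mathbf R)$ is a symmetric association scheme with associate matrices $A_0=I,\dots,A_D$, Bose–Mesner algebra $M$, primitive idempotents $E_0=|X|^{-1}J,\dots,E_D$. Metric: $(X,R_1)$ is distance-regular with $R_i$ its distance-$i$ relation. Cometric: each $E_j$ is a polynomial of degree exactly $j$ in $E_1$ under entrywise multiplication. Antipodal double cover: the relation ''$y=z$ or $(y,z)\in R_D$'' is an equivalence relation on $X$ whose classes all have size $2$. $V=\mathbb C^X$ with standard basis $\{\hat y\}$ and standard Hermitian inner product; $\chi_Y=\sum_{y\in Y}\hat y$. $\delta^*(Y)=\min\{j\ne0:E_j\chi_Y\ne0\}$. $E_i^*(x)$ is diagonal with $(E_i^*(x))_{yy}=(A_i)_{xy}$; $A_i^*(x)$ diagonal with $(A_i^*(x))_{yy}=|X|(E_i)_{xy}$; $T(x)$ is generated by $M$ and the $A_i^*(x)$. For an irreducible $T(x)$-module $W$: $r(W)=\min\{i:E_i^*(x)W\ne0\}$, $r^*(W)=\min\{j:E_jW\ne0\}$. $\psi$ is a relative $t$-codesign with respect to $x$ if $E_i^*(x)\psi$ and $A_i\hat x$ are linearly dependent for all $1\le i\le t$. *)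

(* Defs.v *)
From HB Require Import structures.
From mathcomp Require Import all_boot all_order all_algebra.
Set Implicit Arguments. Unset Strict Implicit. Unset Printing Implicit Defensive.
Import Order.TTheory GRing.Theory Num.Theory.
Local Open Scope ring_scope.

(* X is modelled as 'I_n (n = |X|); the relations R_0..R_D are given by
   a classifying function rel : 'I_n -> 'I_n -> 'I_D.+1, (x,y) \in R_i <-> rel x y = i.
   Vectors of V = C^X are column vectors 'cV[C]_n; C is an (abstract) numClosedFieldType
   (e.g. the complex numbers). *)

Section Scheme.
Variables (C : numClosedFieldType) (n D : nat) (rel : 'I_n -> 'I_n -> 'I_D.+1).

Definition sym_assoc_scheme : Prop :=
  [/\ forall x y, (rel x y == ord0) = (x == y),
      forall x y, rel x y = rel y x,
      forall i, exists x y, rel x y = i &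
      forall i j k, exists p : nat, forall x y, rel x y = k ->
         #|[set z | (rel x z == i) && (rel z y == j)]| = p].

Definition Amx (i : 'I_D.+1) : 'M[C]_n := \matrix_(x, y) (rel x y == i)%:R.

Definition inBM (B : 'M[C]_n) : Prop :=
  exists c : 'I_D.+1 -> C, B = \sum_i c i *: Amx i.

Definition idem (B : 'M[C]_n) : Prop := B *m B = B.

Definition prim_idem (e : 'M[C]_n) : Prop :=
  [/\ inBM e, idem e, e != 0 &
      forall f g, inBM f -> inBM g -> idem f -> idem g -> f *m g = 0 ->
        f != 0 -> g != 0 -> e <> f + g].

Definition prim_idems (E : 'I_D.+1 -> 'M[C]_n) : Prop :=
  [/\ injective E, forall i, prim_idem (E i),
      forall e, prim_idem e -> exists i, e = E i &
      E ord0 = (n%:R)^-1 *: const_mx 1].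

Fixpoint walk (k : nat) (x y : 'I_n) : bool :=
  if k is k'.+1 then [exists z, (rel x z == inord 1) && walk k' z y] else x == y.

Definition graph_dist_is (k : nat) (x y : 'I_n) : bool :=
  walk k x y && [forall j : 'I_k, ~~ walk j x y].

Definition metric : Prop :=
  forall x y (i : 'I_D.+1), (rel x y == i) = graph_dist_is i x y.

(* cometric: E_j is a polynomial of degree exactly j in E_1 under entrywise product
   (the entrywise identity being J, a polynomial p acts entrywise: p.[(E_1)_{xy}]) *)
Definition cometric (E : 'I_D.+1 -> 'M[C]_n) : Prop :=
  forall j : 'I_D.+1, exists p : {poly C},
    size p = (j : nat).+1 /\ E j = \matrix_(x, y) p.[E (inord 1) x y].

Definition ordinary_cycle : Prop :=
  exists f : 'I_n -> 'I_n, bijective f /\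
    forall i j : 'I_n, (rel (f i) (f j) == inord 1) =
      (((i + 1) %% n)%N == j) || (((j + 1) %% n)%N == i).

Definition antipodal_double_cover : Prop :=
  let eqv y z := (y == z) || (rel y z == ord_max) in
  (forall y z w, eqv y z -> eqv z w -> eqv y w) /\
  (forall y, #|[set z | eqv y z]| = 2%N).

Definition hatv (x : 'I_n) : 'cV[C]_n := \col_y (y == x)%:R.
Definition chi (Y : {set 'I_n}) : 'cV[C]_n := \col_y (y \in Y)%:R.

Definition Estar (x : 'I_n) (i : 'I_D.+1) : 'M[C]_n := diag_mx (row x (Amx i)).
Definition Astar (E : 'I_D.+1 -> 'M[C]_n) (x : 'I_n) (i : 'I_D.+1) : 'M[C]_n :=
  diag_mx (n%:R *: row x (E i)).

Inductive inT (E : 'I_D.+1 -> 'M[C]_n) (x : 'I_n) : 'M[C]_n -> Prop :=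
| inT_BM B : inBM B -> inT E x B
| inT_star i : inT E x (Astar E x i)
| inT_one : inT E x 1%:M
| inT_add B B' : inT E x B -> inT E x B' -> inT E x (B + B')
| inT_scale a B : inT E x B -> inT E x (a *: B)
| inT_mul B B' : inT E x B -> inT E x B' -> inT E x (B *m B').

Definition Tmodule E x (W : {vspace 'cV[C]_n}) : Prop :=
  forall B w, inT E x B -> w \in W -> B *m w \in W.

Definition irr_Tmodule E x (W : {vspace 'cV[C]_n}) : Prop :=
  [/\ Tmodule E x W, W != 0%VS &
      forall U : {vspace 'cV[C]_n}, Tmodule E x U -> (U <= W)%VS ->
        U = 0%VS \/ U = W].

Definition least (P : 'I_D.+1 -> Prop) (m : 'I_D.+1) : Prop :=
  P m /\ forall k : 'I_D.+1, (k < m)%N -> ~ P k.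

Definition r_is x (W : {vspace 'cV[C]_n}) (r : 'I_D.+1) : Prop :=
  least (fun i => exists2 w, w \in W & Estar x i *m w != 0) r.
Definition rstar_is (E : 'I_D.+1 -> 'M[C]_n) (W : {vspace 'cV[C]_n}) (r : 'I_D.+1) : Prop :=
  least (fun j => exists2 w, w \in W & E j *m w != 0) r.

Definition dual_degree_is (E : 'I_D.+1 -> 'M[C]_n) (Y : {set 'I_n}) (d : 'I_D.+1) : Prop :=
  least (fun j => j != ord0 /\ E j *m chi Y != 0) d.

Definition lin_dep (u v : 'cV[C]_n) : Prop :=
  exists a b : C, (a != 0 \/ b != 0) /\ a *: u + b *: v = 0.

Definition rel_codesign (x : 'I_n) (t : nat) (psi : 'cV[C]_n) : Prop :=
  forall i : 'I_D.+1, (1 <= i <= t)%N -> lin_dep (Estar x i *m psi) (Amx i *m hatv x).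

End Scheme.

(* Main.v *)
(** Fix [x] in [Y], put [delta = dstar] and suppose [delta <= t].  The part of [E_delta chi_Y]
    orthogonal to the primary module [M x] lies in [E_delta V] and vanishes at distance at
    most [t] from [x].  In an irreducible [T(x)]-module [W] with [r(W) <= r*(W) <= delta], the
    split decomposition of [W] forces such a vector to be orthogonal to [W]; hence
    [E_delta chi_Y] is a multiple of [E_delta x] for every [x] in [Y], so the columns of
    [E_delta] indexed by [Y] agree up to sign.

    A pair in [Y] at distance strictly between [0] and [D] then makes the graph a cycle or
    makes [E_delta] alternate along edges; in the second case [delta = D] because
    multiplication by [E_delta] negates the eigenvalue of [A_1], and [chi_Y] lies in
    [E_0 V + E_D V].  Otherwise all pairs in [Y] are at distance [D].  As [E_1 chi_Y = 0], two
    points of [Y] are antipodes in the [E_1]-embedding; three points are excluded by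
    evaluating [E_1] and [E_2], a quadratic polynomial in [E_1], at a neighbour of [Y]. *)

Require Import Defs.
From HB Require Import structures.
From mathcomp Require Import all_boot all_order all_algebra.
From mathcomp Require Import zify ring.
Set Implicit Arguments. Unset Strict Implicit. Unset Printing Implicit Defensive.
Import Order.TTheory GRing.Theory Num.Theory.
Local Open Scope ring_scope.

(** * Subspaces and minimality *)

(** [P] is an arbitrary proposition, so existence is only doubly negated, which suffices when the
    goal is [False]. The induction is on the dimension. *)
Lemma ex_minimal_vspace (K : fieldType) (vT : vectType K) (P : {vspace vT} -> Prop) :
  (exists U, P U) ->
  ~ ~ exists2 U, P U & forall U', P U' -> (U' <= U)%VS -> U' = U.
Proof.
case=> U PU nomin; have [m] := ubnP (\dim U).
elim: m => // m IHm in U PU *; rewrite ltnS => leUm.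
apply: nomin; exists U => // U' PU' sU'U.
apply/eqP; rewrite eqEdim sU'U leqNgt; apply/negP => ltU'U.
exact: IHm PU' (leq_trans ltU'U leUm).
Qed.

(** A subspace contained in [P] but not exhausting it can be enlarged by a line, so induction on the
    codimension terminates. The double negation avoids deciding whether [P] is exhausted. *)
Lemma vspace_of_pred (K : fieldType) (vT : vectType K) (P : vT -> Prop) :
  P 0 -> (forall a u v, P u -> P v -> P (a *: u + v)) ->
  ~ ~ exists U : {vspace vT}, forall v, v \in U <-> P v.
Proof.
move=> P0 PZD noU.
suff grow m (U : {vspace vT}) : (forall v, v \in U -> P v) -> (\dim {:vT} - \dim U < m)%N -> False.
  by apply: (grow _.+1 0%VS _ (ltnSn _)) => v; rewrite memv0 => /eqP->.
elim: m U => // m IHm U sUP leUm.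
apply: noU; exists U => v; split; first exact: sUP.
move=> Pv; apply: contraT => U'v; exfalso; apply: (IHm (U + <[v]>)%VS).
  move=> _ /memv_addP[u Uu [_ /vlineP[a ->] ->]].
  by rewrite addrC; apply: PZD => //; apply: sUP.
have ltU : (\dim U < \dim (U + <[v]>))%N.
  rewrite ltnNge; apply: contra U'v => leU.
  have /eqP -> : U == (U + <[v]>)%VS by rewrite eqEdim addvSl.
  by rewrite (subvP (addvSr _ _)) ?memv_line.
have := dimvS (subvf (U + <[v]>)%VS); lia.
Qed.

Lemma ex_least D (P : 'I_D.+1 -> Prop) i : P i -> ~ ~ exists m, least P m.
Proof.
move=> Pi noleast; have [m] := ubnP (i : nat).
elim: m => // m IHm in i Pi *; rewrite ltnS => leim.
apply: noleast; exists i; split=> // k ltki Pk.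
exact: IHm Pk (leq_trans ltki leim).
Qed.

Lemma det_free_rows (K : fieldType) m (Q : 'M[K]_m) :
  (forall v : 'rV_m, v *m Q = 0 -> v = 0) -> Q \in unitmx.
Proof.
move=> freeQ; rewrite unitmxE unitfE; apply/negP => /det0P[v nzv vQ].
by rewrite (freeQ v vQ) eqxx in nzv.
Qed.

(** * The Bose-Mesner algebra *)

Section BoseMesner.

Variables (C : numClosedFieldType) (n D : nat) (rel : 'I_n -> 'I_n -> 'I_D.+1).
Hypothesis sch : sym_assoc_scheme rel.

Local Notation A i := (Amx C rel i).
Local Notation BM := (@inBM C n D rel).

Lemma rel_sym x y : rel x y = rel y x. Proof. by case: sch. Qed.

Lemma rel_eq0 x y : (rel x y == ord0) = (x == y). Proof. by case: sch. Qed.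

Lemma rel_xx x : rel x x = ord0. Proof. by apply/eqP; rewrite rel_eq0. Qed.

Lemma rel_surj i : exists x y, rel x y = i. Proof. by case: sch. Qed.

Lemma rel_card x y x' y' i j : rel x y = rel x' y' ->
  #|[set z | (rel x z == i) && (rel z y == j)]| =
  #|[set z | (rel x' z == i) && (rel z y' == j)]|.
Proof.
case: sch => _ _ _ /(_ i j (rel x' y'))[p pP] eq_rel.
by rewrite !pP.
Qed.

(** An intersection number that is positive at one pair is positive at every pair in the same
    relation. *)
Lemma rel_transport x y x' y' z' : rel x y = rel x' y' ->
  exists z, rel x z = rel x' z' /\ rel z y = rel z' y'.
Proof.
move=> /(rel_card (rel x' z') (rel z' y')) eq_card.
have: (0 < #|[set z | (rel x z == rel x' z') && (rel z y == rel z' y')]|)%N.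
  by rewrite eq_card; apply/card_gt0P; exists z'; rewrite inE !eqxx.
by case/card_gt0P=> z; rewrite inE => /andP[/eqP <- /eqP <-]; exists z.
Qed.

Lemma rel_ex x i : exists y, rel x y = i.
Proof.
have [x' [y' <-]] := rel_surj i.
have [|y [<- _]] := @rel_transport x x x' x' y'; first by rewrite !rel_xx.
by exists y.
Qed.

Lemma sum_AE (c : 'I_D.+1 -> C) x y : (\sum_i c i *: A i) x y = c (rel x y).
Proof.
rewrite summxE (bigD1 (rel x y)) //= !mxE eqxx mulr1.
by rewrite big1 ?addr0 // => i ne_i; rewrite !mxE eq_sym (negbTE ne_i) mulr0.
Qed.

Lemma inBM_P B : BM B <-> exists c : 'I_D.+1 -> C, forall x y, B x y = c (rel x y).
Proof.
split=> -[c Bc]; exists c; first by move=> x y; rewrite Bc sum_AE.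
by apply/matrixP => x y; rewrite Bc sum_AE.
Qed.

Lemma BM_rel B x y x' y' : BM B -> rel x y = rel x' y' -> B x y = B x' y'.
Proof. by case/inBM_P => c Bc eq_rel; rewrite !Bc eq_rel. Qed.

Lemma BM_A i : BM (A i).
Proof. by apply/inBM_P; exists (fun j => (j == i)%:R) => x y; rewrite mxE. Qed.

Lemma BM_add B B' : BM B -> BM B' -> BM (B + B').
Proof.
move=> /inBM_P[c Bc] /inBM_P[c' Bc']; apply/inBM_P.
by exists (fun i => c i + c' i) => x y; rewrite mxE Bc Bc'.
Qed.

Lemma BM_scale a B : BM B -> BM (a *: B).
Proof.
move=> /inBM_P[c Bc]; apply/inBM_P.
by exists (fun i => a * c i) => x y; rewrite mxE Bc.
Qed.

Lemma BM_sub B B' : BM B -> BM B' -> BM (B - B').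
Proof. by move=> BMB BMB'; rewrite -scaleN1r; apply/BM_add/BM_scale. Qed.

Lemma BM_map (f : C -> C) B : BM B -> BM (map_mx f B).
Proof.
move=> /inBM_P[c Bc]; apply/inBM_P.
by exists (fun i => f (c i)) => x y; rewrite mxE Bc.
Qed.

Lemma BM_had B B' : BM B -> BM B' -> BM (\matrix_(x, y) (B x y * B' x y)).
Proof.
move=> /inBM_P[c Bc] /inBM_P[c' Bc']; apply/inBM_P.
by exists (fun i => c i * c' i) => x y; rewrite mxE Bc Bc'.
Qed.

Lemma BM_tr B : BM B -> B^T = B.
Proof. by case/inBM_P => c Bc; apply/matrixP=> x y; rewrite mxE !Bc rel_sym. Qed.

Lemma BM_sym B x y : BM B -> B x y = B y x.
Proof. by case/inBM_P => c Bc; rewrite !Bc rel_sym. Qed.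

Lemma BM_1 : BM 1%:M.
Proof.
apply/inBM_P; exists (fun i => (i == ord0)%:R) => x y.
by rewrite mxE rel_eq0.
Qed.

Lemma BM_mul B B' : BM B -> BM B' -> BM (B *m B').
Proof.
move=> /inBM_P[c Bc] /inBM_P[c' Bc'].
have sumE x y : (B *m B') x y = \sum_i \sum_j c i * c' j *
    #|[set z | (rel x z == i) && (rel z y == j)]|%:R.
  have -> : (B *m B') x y = \sum_z \sum_i \sum_j
      c i * c' j * ((rel x z == i) && (rel z y == j))%:R.
    rewrite mxE; apply: eq_bigr => z _.
    rewrite (bigD1 (rel x z)) //= (bigD1 (rel z y)) //= !eqxx Bc Bc' mulr1.
    rewrite big1 ?addr0 ?big1 ?addr0 // => [i ne_i|j ne_j]; last first.
      by rewrite eq_sym (negbTE ne_j) mulr0.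
    by rewrite big1 // => j _; rewrite eq_sym (negbTE ne_i) mulr0.
  rewrite exchange_big; apply: eq_bigr => i _.
  rewrite exchange_big; apply: eq_bigr => j _.
  rewrite -mulr_sumr -natr_sum; congr (_ * _%:R).
  by rewrite -sum1dep_card [RHS]big_mkcond; apply: eq_bigr => z _; case: (_ && _).
apply/inBM_P.
(* The coefficient of class [k] is read off at some pair in that relation; for [k = rel x y] such a
   pair exists, so the default 0 is not reached. *)
exists (fun k => if [pick p | rel p.1 p.2 == k] is Some p then (B *m B') p.1 p.2 else 0).
move=> x y; case: pickP => [[x' y'] /= /eqP eq_rel | /(_ (x, y))]; last by rewrite eqxx.
rewrite !sumE; apply: eq_bigr => i _; apply: eq_bigr => j _.
by rewrite (rel_card i j eq_rel).
Qed.

(** Transposition reverses products and fixes every element of the Bose-Mesner algebra. *)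
Lemma BM_comm B B' : BM B -> BM B' -> B *m B' = B' *m B.
Proof.
move=> BMB BMB'; have := BM_tr (BM_mul BMB BMB').
by rewrite trmx_mul !BM_tr.
Qed.

End BoseMesner.

(** * Primitive idempotents *)

Section Idempotents.

Variables (C : numClosedFieldType) (n D : nat) (rel : 'I_n -> 'I_n -> 'I_D.+1).
Variable E : 'I_D.+1 -> 'M[C]_n.
Hypotheses (sch : sym_assoc_scheme rel) (primE : prim_idems rel E).

Local Notation A i := (Amx C rel i).
Local Notation BM := (@inBM C n D rel).

Lemma E_prim j : prim_idem rel (E j). Proof. by case: primE. Qed.
Lemma E_BM j : BM (E j). Proof. by case: (E_prim j). Qed.
Lemma E_idem j : E j *m E j = E j. Proof. by case: (E_prim j). Qed.
Lemma E_neq0 j : E j != 0. Proof. by case: (E_prim j). Qed.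
Lemma E_0 x y : E ord0 x y = n%:R^-1.
Proof. by case: primE => _ _ _ ->; rewrite !mxE mulr1. Qed.
Lemma E_sym j x y : E j x y = E j y x. Proof. exact/(BM_sym sch)/E_BM. Qed.

Lemma E_rel j x y x' y' : rel x y = rel x' y' -> E j x y = E j x' y'.
Proof. exact/BM_rel/E_BM. Qed.

(** Otherwise [e f] and [e - e f] would be nonzero orthogonal idempotents of the algebra with sum
    [e]. *)
Lemma prim_idem_mul (e f : 'M[C]_n) : prim_idem rel e -> prim_idem rel f ->
  e *m f = 0 \/ e *m f = e.
Proof.
move=> [BMe ide _ irre] [BMf idf _ _].
have [->|nz_ef] := eqVneq (e *m f) 0; first by left.
right; apply/eqP; rewrite eq_sym -subr_eq0; apply: contraT => nz_g.
have fe := BM_comm sch BMf BMe.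
have eef : e *m (e *m f) = e *m f by rewrite mulmxA ide.
have efe : e *m f *m e = e *m f by rewrite -mulmxA fe.
have ef2 : e *m f *m (e *m f) = e *m f by rewrite mulmxA efe -mulmxA idf.
case: (irre (e *m f) (e - e *m f)) => //.
- exact: BM_mul.
- by apply: BM_sub; last exact: BM_mul.
- by rewrite /idem mulmxBl !mulmxBr ide eef efe ef2 subrr subr0.
- by rewrite mulmxBr efe ef2 subrr.
- by rewrite addrC subrK.
Qed.

Lemma E_orth i j : i != j -> E i *m E j = 0.
Proof.
move=> ne_ij; have [//|Eij] := prim_idem_mul (E_prim i) (E_prim j).
have [Eji|Eji] := prim_idem_mul (E_prim j) (E_prim i).
  by rewrite (BM_comm sch (E_BM _) (E_BM _)) Eji.
case: primE => injE _ _ _; case/eqP: ne_ij; apply: injE.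
by rewrite -Eij -{2}Eji (BM_comm sch (E_BM _) (E_BM _)).
Qed.

(** Nonzero orthogonal idempotents are independent, and there are as many of them as relations; so
    the matrix [Q] of their values on the relations is invertible. *)
Lemma BM_span B : BM B -> exists c : 'I_D.+1 -> C, B = \sum_j c j *: E j.
Proof.
have /fin_all_exists[q qE] j := (inBM_P rel (E j)).1 (E_BM j).
pose Q : 'M[C]_D.+1 := \matrix_(j, i) q j i.
have sumQ (v : 'rV_D.+1) x y : (v *m Q) 0 (rel x y) = (\sum_j v 0 j *: E j) x y.
  by rewrite summxE mxE; apply: eq_bigr => j _; rewrite !mxE qE.
case/inBM_P=> c Bc.
have Qunit : Q \in unitmx.
  apply: det_free_rows => v vQ; apply/rowP => j; rewrite mxE.
  have sum0 : \sum_j v 0 j *: E j = 0.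
    by apply/matrixP => x y; rewrite -sumQ vQ !mxE.
  have := congr1 (mulmx^~ (E j)) sum0.
  rewrite mul0mx mulmx_suml (bigD1 j) //= big1 => [|i ne_ij].
    by rewrite addr0 -scalemxAl E_idem => /eqP; rewrite scaler_eq0 (negbTE (E_neq0 j)) orbF => /eqP.
  by rewrite -scalemxAl E_orth // scaler0.
exists (fun j => (\row_i c i *m invmx Q) 0 j); apply/matrixP=> x y.
by rewrite -sumQ mulmxKV // mxE Bc.
Qed.

Lemma span_mulE (c : 'I_D.+1 -> C) j : (\sum_i c i *: E i) *m E j = c j *: E j.
Proof.
rewrite mulmx_suml (bigD1 j) //= big1 => [|i ne_ij].
  by rewrite addr0 -scalemxAl E_idem.
by rewrite -scalemxAl E_orth // scaler0.
Qed.

Lemma BM_eig B : BM B ->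
  exists c : 'I_D.+1 -> C, forall j, B *m E j = c j *: E j /\ E j *m B = c j *: E j.
Proof.
move=> BMB; have [c Bc] := BM_span BMB; exists c => j.
by rewrite (BM_comm sch (E_BM _) BMB) Bc span_mulE.
Qed.

Lemma sum_E : \sum_j E j = 1%:M.
Proof.
have [c c1] := BM_span (BM_1 C sch).
rewrite c1; apply: eq_bigr => j _.
have := span_mulE c j; rewrite -c1 mul1mx => E_cE.
by rewrite -E_cE.
Qed.

(** Conjugation permutes the primitive idempotents. If it sent [E j] to a different [E l], a
    diagonal entry of their zero product would be a sum of squared moduli of entries of [E j], so
    these entries would be zero and hence real anyway. *)
Lemma E_conj j x y : (E j x y)^* = E j x y.
Proof.
pose cj (B : 'M[C]_n) := map_mx (Num.conj : C -> C) B.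
have cjK : involutive cj by move=> B; apply/matrixP=> a b; rewrite !mxE conjCK.
have cjM (B B' : 'M_n) : cj (B *m B') = cj B *m cj B' by exact: map_mxM.
have cjidem B : idem B -> idem (cj B) by move=> idB; rewrite /idem -cjM idB.
have cj0 B : cj B = 0 -> B = 0.
  by move/(congr1 cj); rewrite cjK => ->; apply/matrixP=> a b; rewrite !mxE conjC0.
have [l El] : exists l, cj (E j) = E l.
  case: primE => _ _ + _; apply; have [BMe ide nze irre] := E_prim j; split.
  - exact: BM_map.
  - exact: cjidem.
  - by apply: contraNneq nze => /cj0->.
  move=> f g BMf BMg idf idg fg nzf nzg /(congr1 cj); rewrite cjK => Efg.
  apply: (irre (cj f) (cj g)); rewrite ?Efg.
  - exact: BM_map.
  - exact: BM_map.
  - exact: cjidem.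
  - exact: cjidem.
  - by rewrite -cjM fg /cj map_mx0.
  - by apply: contraNneq nzf => /cj0->.
  - by apply: contraNneq nzg => /cj0->.
  - by rewrite /cj map_mxD.
have [eq_lj|ne_lj] := eqVneq l j; first by rewrite -{2}eq_lj -El mxE.
have /matrixP/(_ x x) := E_orth ne_lj.
rewrite -El mxE [RHS]mxE => /eqP; rewrite psumr_eq0 => [|z _]; last first.
  by rewrite mxE [E j z x]E_sym mulrC mul_conjC_ge0.
move/allP/(_ y (mem_index_enum _)); rewrite /= mxE [E j y x]E_sym mulrC mul_conjC_eq0.
by move/eqP->; rewrite conjC0.
Qed.

(** [E j] is the Gram matrix of its own columns. *)
Lemma E_sqr j x y : E j x y = \sum_z E j z x * E j z y.
Proof.
by rewrite -{1}E_idem mxE; apply: eq_bigr => z _; rewrite [E j x z]E_sym.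
Qed.

Lemma E_diag j x y : E j x x = E j y y.
Proof. by apply: E_rel; rewrite !(rel_xx sch). Qed.

Lemma E_normr j x y : E j x y * E j x y = `|E j x y| ^+ 2.
Proof. by rewrite normCK E_conj. Qed.

Lemma E_diag_neq0 j x : E j x x != 0.
Proof.
apply: contraNneq (E_neq0 j) => Exx0; apply/eqP/matrixP => y z.
have /eqP : \sum_y E j y z * E j y z = 0 by rewrite -E_sqr (E_diag j z x).
rewrite psumr_eq0 => [/allP/(_ y (mem_index_enum _))|w _].
  by rewrite /= mulf_eq0 orbb mxE => /eqP.
by rewrite E_normr exprn_ge0.
Qed.

(** This is the equality case of Cauchy-Schwarz: by [E_sqr], the squared norm of column [y] minus
    [eps] times column [x] expands to zero. The factor [eps] is real, being a quotient of real
    entries. *)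
Lemma E_parallel j x y eps : eps * eps = 1 -> E j x y = eps * E j x x ->
  forall z, E j z y = eps * E j z x.
Proof.
move=> eps2 Exy z.
have epsC : eps^* = eps.
  have := congr1 Num.conj Exy; rewrite rmorphM /= !E_conj Exy => /mulIf.
  by move/(_ (E_diag_neq0 j x)).
have /eqP : \sum_z (E j z y - eps * E j z x) * (E j z y - eps * E j z x) = 0.
  have -> : \sum_z (E j z y - eps * E j z x) * (E j z y - eps * E j z x) =
    (\sum_z E j z y * E j z y + eps * eps * \sum_z E j z x * E j z x)
      - (eps + eps) * \sum_z E j z x * E j z y.
    by rewrite !mulr_sumr -big_split /= -sumrB; apply: eq_bigr => w _; ring.
  by rewrite -!E_sqr eps2 Exy (E_diag j y x); ring: eps2.
rewrite psumr_eq0 => [/allP/(_ z (mem_index_enum _))|w _].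
  by rewrite /= mulf_eq0 orbb subr_eq0 => /eqP.
have -> : (E j w y - eps * E j w x) * (E j w y - eps * E j w x) =
          `|E j w y - eps * E j w x| ^+ 2.
  by rewrite normCK rmorphB rmorphM /= epsC !E_conj.
exact: exprn_ge0.
Qed.

Lemma E_trace_neq0 j : \sum_x E j x x != 0.
Proof.
have [x0 _] := rel_surj sch ord0.
rewrite (eq_bigr (fun=> E j x0 x0)) => [|x _]; last exact: E_diag.
rewrite sumr_const card_ord mulrn_eq0 negb_or E_diag_neq0 andbT.
by case: (n) x0 => [[]|].
Qed.

(** Summing an entrywise product with the symmetric [E l] gives the trace of the matrix product,
    which isolates the coefficient [c l]. *)
Lemma sum_had_E (c : 'I_D.+1 -> C) l :
  \sum_x \sum_y (\sum_j c j *: E j) x y * E l x y = c l * \sum_x E l x x.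
Proof.
rewrite mulr_sumr; apply: eq_bigr => x _.
have /matrixP/(_ x x) := span_mulE c l.
by rewrite !mxE => <-; apply: eq_bigr => y _; rewrite [E l x y]E_sym.
Qed.

End Idempotents.

(** * Metric and cometric schemes *)

(** Triangular elimination: a multiple of the polynomial of the same degree removes the leading
    term. *)
Lemma poly_graded_span (F : fieldType) D (p : 'I_D.+1 -> {poly F}) m (q : {poly F}) :
  (forall j : 'I_D.+1, size (p j) = j.+1) -> (size q <= m <= D.+1)%N ->
  exists c : 'I_D.+1 -> F,
    q = \sum_j c j *: p j /\ forall j : 'I_D.+1, (m <= j)%N -> c j = 0.
Proof.
move=> size_p; elim: m q => [|m IHm] q /andP[le_qm le_mD].
  exists (fun=> 0); split=> //; rewrite big1 => [|j _]; last exact: scale0r.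
  by apply/eqP; rewrite -size_poly_eq0 -leqn0.
pose k : 'I_D.+1 := Ordinal le_mD.
pose a := q`_m / lead_coef (p k).
have nz_lead : lead_coef (p k) != 0 by rewrite lead_coef_eq0 -size_poly_eq0 size_p.
have [|c [qE c0]] := IHm (q - a *: p k).
  rewrite (ltnW le_mD) andbT; apply/leq_sizeP => i le_mi.
  rewrite coefB coefZ; case: (ltngtP m i) le_mi => // [lt_mi _|<- _].
    rewrite (leq_sizeP _ _ le_qm) // (leq_sizeP _ _ (_ : size (p k) <= m.+1)%N) ?size_p //.
    by rewrite mulr0 subr0.
  by rewrite /a /lead_coef size_p /= divfK ?subrr // -[m]/(m.+1.-1) -(size_p k).
exists (fun j => c j + (j == k)%:R * a); split.
  under eq_bigr do rewrite scalerDl.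
  rewrite big_split -qE /= [in X in _ + X](bigD1 k) //= eqxx mul1r big1 ?addr0 ?subrK //.
  by move=> j /negbTE->; rewrite mul0r scale0r.
move=> j lt_mj; rewrite c0 1?ltnW // add0r.
have -> : (j == k) = false by apply/negbTE; rewrite -val_eqE /= gtn_eqF.
by rewrite mul0r.
Qed.

(** * Graph distance and generation of the Bose-Mesner algebra by [A_1] *)

Section Metric.

Variables (C : numClosedFieldType) (n D : nat) (rel : 'I_n -> 'I_n -> 'I_D.+1).
Hypotheses (Dgt0 : (0 < D)%N) (sch : sym_assoc_scheme rel) (met : metric rel).

Local Notation A i := (Amx C rel i).
Local Notation BM := (@inBM C n D rel).
Local Notation d x y := (nat_of_ord (rel x y)).

Lemma adjE x y : (rel x y == inord 1) = (d x y == 1%N).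
Proof. by rewrite -val_eqE /= inordK. Qed.

Lemma dist_sym x y : d x y = d y x. Proof. by rewrite (rel_sym sch). Qed.

Lemma dist_eq0 x y : (d x y == 0%N) = (x == y).
Proof. by rewrite -(rel_eq0 sch). Qed.

Lemma dist_walk x y : walk rel (d x y) x y.
Proof. by have := met x y (rel x y); rewrite eqxx => /esym/andP[]. Qed.

Lemma walk_dist k x y : walk rel k x y -> (d x y <= k)%N.
Proof.
move=> wk; rewrite leqNgt; apply/negP => lt_k.
have := met x y (rel x y); rewrite eqxx => /esym/andP[_ /forallP/(_ (Ordinal lt_k))].
by rewrite wk.
Qed.

Lemma dist_adj x y z : d y z = 1%N -> (d x z <= (d x y).+1)%N.
Proof.
move=> yz; rewrite dist_sym (dist_sym x y); apply: walk_dist => /=.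
by apply/existsP; exists y; rewrite adjE dist_sym yz dist_walk.
Qed.

Lemma dist_step x y k : d x y = k.+1 -> exists z, d x z = k /\ d z y = 1%N.
Proof.
move=> dxy; have := dist_walk y x; rewrite dist_sym dxy => /= /existsP[z /andP[]].
rewrite adjE dist_sym => /eqP zy /walk_dist le_k; exists z; split=> //.
apply/eqP; rewrite eqn_leq dist_sym le_k /= -ltnS -dxy dist_sym (dist_sym z).
by rewrite dist_sym; apply: dist_adj.
Qed.

Lemma dist_up x y : (d x y < D)%N -> exists z, d x z = (d x y).+1 /\ d y z = 1%N.
Proof.
move=> ltD; have [x' [y' dxy']] := rel_surj sch (inord (d x y).+1).
have {}dxy' : d x' y' = (d x y).+1 by rewrite dxy' inordK.
have [z' [xz zy]] := dist_step dxy'.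
have [|z [xz' zy']] := @rel_transport _ _ _ sch x y x' z' y'; first exact/val_inj.
by exists z; rewrite xz' dxy' (dist_sym y) zy' (dist_sym y').
Qed.

(** [A_1] generates the algebra: the product of [A_1] and [A_k] involves no class beyond [k+1] and
    has a nonzero coefficient there, so it can be solved for the next associate matrix. *)
Lemma metric_ind (P : 'M[C]_n -> Prop) :
  P 1%:M -> (forall B B', P B -> P B' -> P (B + B')) ->
  (forall a B, P B -> P (a *: B)) -> (forall B, P B -> P (A (inord 1) *m B)) ->
  forall B, BM B -> P B.
Proof.
move=> P1 PD PZ PM.
have P0 : P 0 by rewrite -(scale0r 1%:M); apply: PZ.
have Psum (I : finType) (Q : pred I) F : (forall i, Q i -> P (F i)) -> P (\sum_(i | Q i) F i).
  by move=> PF; apply: big_ind.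
suff PA m (i : 'I_D.+1) : (i < m)%N -> P (A i).
  by move=> _ [c ->]; apply: Psum => i _; apply/PZ/(PA D.+1).
elim: m i => // m IHm i; rewrite ltnS leq_eqVlt => /predU1P[im|]; last exact: IHm.
case: m im IHm => [|k] im IHm.
  suff -> : A i = 1%:M by [].
  apply/matrixP=> x y; rewrite !mxE -(rel_eq0 sch).
  by congr (_ == _)%:R; apply: val_inj.
have kD : (k < D.+1)%N by rewrite ltnW // -im.
pose j := Ordinal kD.
have [c cE] := BM_mul sch (BM_A C rel (inord 1)) (BM_A C rel j).
have cP x y : c (rel x y) = \sum_z ((d x z == 1%N) && (d z y == k))%:R.
  by rewrite -sum_AE -cE mxE; apply: eq_bigr => z _; rewrite !mxE adjE -mulnb natrM -val_eqE.
have c_far (l : 'I_D.+1) : (k.+1 < l)%N -> c l = 0.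
  have [x [y <-]] := rel_surj sch l; rewrite cP => lt_k.
  apply: big1 => z _; case: eqP => //= xz; case: eqP => // zy.
  have := @dist_adj y z x; rewrite dist_sym xz => /(_ erefl).
  by rewrite dist_sym leqNgt (dist_sym y z) zy lt_k.
have ci : c i != 0.
  have [x [y xy]] := rel_surj sch i; rewrite -xy cP.
  have [|z [xz zy]] := @dist_step y x k; first by rewrite dist_sym xy im.
  rewrite psumr_eq0 => [|w _]; last exact: ler0n.
  apply/negP => /allP/(_ z (mem_index_enum _)).
  by rewrite /= dist_sym zy dist_sym xz !eqxx oner_eq0.
have -> : A i = (c i)^-1 *: (A (inord 1) *m A j + (-1) *: \sum_(l : 'I_D.+1 | (l < k.+1)%N) c l *: A l).
  rewrite cE (bigID (fun l : 'I_D.+1 => (l < k.+1)%N)) /= scaleN1r addrAC subrr add0r.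
  rewrite (bigD1 i) /=; last by rewrite im ltnn.
  rewrite big1 => [|l /andP[le_l ne_l]]; first by rewrite addr0 scalerA mulVf ?scale1r.
  rewrite c_far ?scale0r // ltn_neqAle leqNgt le_l andbT eq_sym -im.
  by rewrite val_eqE.
apply: (PZ); apply: PD; first by apply/PM/IHm.
by apply: (PZ); apply: Psum => l lt_l; apply/PZ/IHm.
Qed.

End Metric.

(** * Polynomial structure and vanishing Krein parameters *)

Section Cometric.

Variables (C : numClosedFieldType) (n D : nat) (rel : 'I_n -> 'I_n -> 'I_D.+1).
Variable E : 'I_D.+1 -> 'M[C]_n.
Hypotheses (Dgt0 : (0 < D)%N) (sch : sym_assoc_scheme rel) (primE : prim_idems rel E).

Local Notation A i := (Amx C rel i).
Local Notation BM := (@inBM C n D rel).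
Local Notation E1 := (E (inord 1)).

(** Since [A_1] generates the algebra, every element would have equal eigenvalues on [E j] and
    [E l]; the element [E j] itself does not if [j] and [l] differ. *)
Lemma E_eig_inj (met : metric rel) a j l :
  A (inord 1) *m E j = a *: E j -> A (inord 1) *m E l = a *: E l -> j = l.
Proof.
move=> Aj Al; apply/eqP/negPn/negP => ne_jl.
have [|B B' [c [Bj Bl]] [c' [Bj' Bl']]|b B [c [Bj Bl]]|B [c [Bj Bl]]|c [cj cl]] :=
  @metric_ind C n D rel Dgt0 sch met
    (fun B => exists c, B *m E j = c *: E j /\ B *m E l = c *: E l) _ _ _ _ (E j) (E_BM primE j).
- by exists 1; rewrite !mul1mx !scale1r.
- by exists (c + c'); rewrite !mulmxDl Bj Bl Bj' Bl' !scalerDl.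
- by exists (b * c); rewrite -!scalemxAl Bj Bl !scalerA.
- by exists (c * a); rewrite -!mulmxA Bj Bl -!scalemxAr Aj Al !scalerA.
move/eqP: cl; rewrite (E_orth sch primE ne_jl) eq_sym scaler_eq0 (negbTE (E_neq0 primE l)) orbF.
move=> /eqP c0; move/eqP: cj; rewrite (E_idem primE) c0 scale0r.
exact/negP/(E_neq0 primE).
Qed.

Hypothesis comet : cometric E.

(** Every [E j], and therefore every [A i], is a function of the entries of [E_1]. *)
Lemma E1_inj x y x' y' : E1 x y = E1 x' y' -> rel x y = rel x' y'.
Proof.
move=> eqE1; have eqE j : E j x y = E j x' y'.
  by have [p [_ ->]] := comet j; rewrite !mxE eqE1.
have [c cE] := BM_span sch primE (BM_A C rel (rel x y)).
have: A (rel x y) x y = A (rel x y) x' y'.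
  by rewrite cE !summxE; apply: eq_bigr => j _; rewrite !mxE eqE.
by rewrite !mxE eqxx; case: eqP => // _ /eqP; rewrite oner_eq0.
Qed.

(** Entrywise multiplication by [E_1] multiplies the polynomial of [E h] by ['X], giving degree
    exactly [h+1]. The [c l] are Krein parameters up to scaling. *)
Lemma E1_had h : exists c : 'I_D.+1 -> C,
  [/\ forall x y, E1 x y * E h x y = (\sum_l c l *: E l) x y,
      forall l : 'I_D.+1, (h.+1 < l)%N -> c l = 0 &
      forall l : 'I_D.+1, l = h.+1 :> nat -> c l != 0].
Proof.
have /fin_all_exists[p pP] := comet.
have size_p j : size (p j) = j.+1 by case: (pP j).
have pE j x y : E j x y = (p j).[E1 x y] by rewrite {1}(pP j).2 mxE.
have sumE (c : 'I_D.+1 -> C) q : q = \sum_j c j *: p j ->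
    forall x y, q.[E1 x y] = (\sum_l c l *: E l) x y.
  move=> -> x y; rewrite horner_sum summxE.
  by apply: eq_bigr => l _; rewrite hornerZ mxE -pE.
(* For [h = D] both conditions on [c] are vacuous, and closure of the algebra under entrywise
   products suffices. *)
have [lt_hD|le_Dh] := ltnP h D; last first.
  have := BM_had (E_BM primE (inord 1)) (E_BM primE h).
  case/(BM_span sch primE) => c cE; exists c; split=> [x y|l|l lh].
  - by rewrite -cE mxE.
  - by move=> lt_hl; suff: (D < l)%N; [rewrite ltnNge -ltnS ltn_ord | lia].
  - by suff: (D < l)%N; [rewrite ltnNge -ltnS ltn_ord | lia].
pose q := 'X * p h.
have size_q : size q = h.+2 by rewrite /q mulrC size_mulX ?size_p // -size_poly_eq0 size_p.
have [|c [qE c0]] := @poly_graded_span C D p h.+2 q size_p.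
  by rewrite size_q leqnn.
exists c; split=> [x y|l|l lh].
- by rewrite -(sumE _ _ qE) hornerM hornerX -pE.
- exact: c0.
apply/eqP => cl0; have: (size q <= h.+1)%N.
  rewrite qE; apply: (leq_trans (size_sum _ _ _)); apply/bigmax_leqP => j _.
  have [le_jh|] := leqP j h; first by rewrite (leq_trans (size_scale_leq _ _)) // size_p.
  rewrite leq_eqVlt => /predU1P[hj|lt_hj]; last by rewrite c0 // scale0r size_poly0.
  have /= -> : j = l by apply: val_inj; rewrite /= lh.
  by rewrite cl0 scale0r size_poly0.
by rewrite size_q ltnn.
Qed.

Lemma triple_sum (h l : 'I_D.+1) : (h.+1 < l)%N -> \sum_x \sum_y E1 x y * E h x y * E l x y = 0.
Proof.
have [c [cE c0 _]] := E1_had h => lt_hl.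
under eq_bigr do under eq_bigr do rewrite cE.
by rewrite (sum_had_E sch primE) c0 // mul0r.
Qed.

(* The Krein parameter vanishes with the sum of squares of all the numbers
   [sum_w (E_h)_yw (E_1)_xw (E_l)_wz]. *)
Lemma E_Astar_E (h l : 'I_D.+1) x : (h.+1 < l)%N -> E h *m diag_mx (row x E1) *m E l = 0.
Proof.
move=> lt_hl; pose M u := E h *m diag_mx (row u E1) *m E l.
have ME u y z : M u y z = \sum_w E h y w * E1 u w * E l w z.
  by rewrite /M mxE; apply: eq_bigr => w _; rewrite mul_mx_diag !mxE.
have M_real u y z : M u y z * M u y z = `|M u y z| ^+ 2.
  rewrite normCK; congr (_ * _); rewrite ME rmorph_sum; apply: eq_bigr => w _.
  by rewrite /= !rmorphM /= !(E_conj sch primE).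
have trM u : \sum_y \sum_z M u y z * M u y z =
    \sum_w \sum_v E h v w * E l v w * (E1 u v * E1 u w).
  have -> : \sum_y \sum_z M u y z * M u y z = \tr (M u *m (M u)^T).
    by apply: eq_bigr => y _; rewrite [RHS]mxE; apply: eq_bigr => z _; rewrite [_^T z y]mxE.
  have -> : (M u)^T = E l *m diag_mx (row u E1) *m E h.
    by rewrite !trmx_mul tr_diag_mx !(BM_tr sch (E_BM primE _)) mulmxA.
  have -> : M u *m (E l *m diag_mx (row u E1) *m E h) =
      E h *m ((diag_mx (row u E1) *m E l) *m (diag_mx (row u E1) *m E h)).
    by rewrite /M !mulmxA -[_ *m E l *m E l]mulmxA (E_idem primE).
  rewrite mxtrace_mulC -!mulmxA (E_idem primE) mulmxA.
  apply: eq_bigr => w _; rewrite mxE; apply: eq_bigr => v _.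
  rewrite !mul_diag_mx !mxE (E_sym sch primE l); ring.
have : \sum_u \sum_y \sum_z M u y z * M u y z = 0.
  under eq_bigr do rewrite trM.
  rewrite -{}[RHS](triple_sum lt_hl) exchange_big; apply: eq_bigr => w _.
  rewrite exchange_big; apply: eq_bigr => v _.
  rewrite -mulr_sumr -(E_sqr sch primE).
  rewrite (E_sym sch primE (inord 1)) (E_sym sch primE h) (E_sym sch primE l); ring.
move/eqP; rewrite psumr_eq0 => [/allP/(_ x (mem_index_enum _))/=|u _]; last first.
  by do 2![apply: sumr_ge0 => ? _]; rewrite M_real exprn_ge0.
rewrite psumr_eq0 => [/allP sum0|y _]; last first.
  by apply: sumr_ge0 => ? _; rewrite M_real exprn_ge0.
apply/matrixP => y z; rewrite [RHS]mxE; have /= := sum0 y (mem_index_enum _).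
rewrite psumr_eq0 => [/allP/(_ z (mem_index_enum _))/=|w _]; last first.
  by rewrite M_real exprn_ge0.
by rewrite mulf_eq0 orbb => /eqP.
Qed.

Lemma E2_quadratic : (1 < D)%N -> exists al be ga : C, ga != 0 /\
  forall x y, E (inord 2) x y = al + be * E1 x y + ga * (E1 x y * E1 x y).
Proof.
move=> Dgt1; have [p [size_p Ep]] := comet (inord 2).
rewrite inordK // in size_p; exists p`_0, p`_1, p`_2; split.
  by rewrite -[2%N]/(3.-1) -size_p -lead_coefE lead_coef_eq0 -size_poly_eq0 size_p.
move=> x y; rewrite {1}Ep mxE horner_coef size_p !big_ord_recr big_ord0 /=.
by rewrite expr2; ring.
Qed.

End Cometric.

(** * Terwilliger modules *)

Section Dot.

Variables (C : numClosedFieldType) (n : nat).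

Definition dot (u v : 'cV[C]_n) : C := \sum_y (u y 0)^* * v y 0.

Definition adj (B : 'M[C]_n) : 'M[C]_n := (map_mx Num.conj B)^T.

Lemma dot_adj B u v : dot u (B *m v) = dot (adj B *m u) v.
Proof.
rewrite /dot; under eq_bigr do rewrite mxE mulr_sumr.
rewrite exchange_big; apply: eq_bigr => y _.
rewrite mxE rmorph_sum mulr_suml; apply: eq_bigr => z _.
by rewrite !mxE rmorphM /= conjCK mulrCA mulrA.
Qed.

Lemma adjK : involutive adj.
Proof. by move=> B; apply/matrixP=> y z; rewrite !mxE conjCK. Qed.

Lemma dotDr u v w : dot u (v + w) = dot u v + dot u w.
Proof. by rewrite -big_split; apply: eq_bigr => y _; rewrite mxE mulrDr. Qed.

Lemma dot_eq0 v : dot v v = 0 -> v = 0.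
Proof.
move/eqP; rewrite psumr_eq0 => [/allP v0|y _]; last by rewrite mulrC mul_conjC_ge0.
apply/colP => y; rewrite mxE; apply/eqP.
by have := v0 y (mem_index_enum _); rewrite /= mulrC mul_conjC_eq0.
Qed.

End Dot.

Section Terwilliger.

Variables (C : numClosedFieldType) (n D : nat) (rel : 'I_n -> 'I_n -> 'I_D.+1).
Variable E : 'I_D.+1 -> 'M[C]_n.
Hypotheses (Dgt0 : (0 < D)%N) (sch : sym_assoc_scheme rel) (primE : prim_idems rel E).
Hypotheses (met : metric rel) (comet : cometric E).
Variable x : 'I_n.

Local Notation A i := (Amx C rel i).
Local Notation A1 := (A (inord 1)).
Local Notation BM := (@inBM C n D rel).
Local Notation E1 := (E (inord 1)).
Local Notation T := (inT rel E x).
Local Notation d x y := (nat_of_ord (rel x y)).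
Local Notation D1 := (diag_mx (row x E1)).

Let n_neq0 : n%:R != 0 :> C.
Proof. by rewrite pnatr_eq0 -lt0n; case: (n) x => [[]|]. Qed.

Lemma diag_mulE (v : 'rV[C]_n) (w : 'cV[C]_n) y : (diag_mx v *m w) y 0 = v 0 y * w y 0.
Proof. by rewrite mul_diag_mx mxE. Qed.

(** [T(x)] is generated by [A_1] and the diagonal matrix [D1] of row [x] of [E_1]: the metric
    property yields the Bose-Mesner algebra, and the cometric one makes each [Astar] a polynomial in
    [D1]. *)
Lemma T_stable (P : 'cV[C]_n -> Prop) :
  (forall a u v, P u -> P v -> P (a *: u + v)) ->
  (forall u, P u -> P (A1 *m u)) -> (forall u, P u -> P (D1 *m u)) ->
  forall B, T B -> forall u, P u -> P (B *m u).
Proof.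
move=> Plin PA PD.
have PZ a u : P u -> P (a *: u).
  move=> Pu; have P0 : P 0 by have := Plin (-1) u u Pu Pu; rewrite scaleN1r addNr.
  by rewrite -[a *: u]addr0; apply: Plin.
have Padd u v : P u -> P v -> P (u + v).
  by move=> Pu Pv; rewrite -[u]scale1r; apply: Plin.
move=> B; elim=> {B} [B BMB|i||B B' _ PB _ PB'|a B _ PB|B B' _ PB _ PB'] u Pu.
- move: B BMB u Pu; apply: (metric_ind Dgt0 sch met)
    => [u|B B' PB PB' u Pu|a B PB u Pu|B PB u Pu].
  + by rewrite mul1mx.
  + by rewrite mulmxDl; apply: Padd; [apply: PB|apply: PB'].
  + by rewrite -scalemxAl; apply/PZ/PB.
  + by rewrite -mulmxA; apply/PA/PB.
- have [p [_ Ei]] := comet i.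
  suff Pp q : P (diag_mx (\row_y q.[E1 x y]) *m u).
    have -> : Astar E x i *m u = n%:R *: (diag_mx (\row_y p.[E1 x y]) *m u).
      by apply/colP=> y; rewrite /Astar [RHS]mxE !diag_mulE !mxE {1}Ei !mxE mulrA.
    exact/PZ/Pp.
  elim/poly_ind: q => [|q c Pq].
    have -> : diag_mx (\row_y 0.[E1 x y]) *m u = 0 *: u.
      by apply/colP=> y; rewrite diag_mulE !mxE horner0.
    exact: PZ.
  have -> : diag_mx (\row_y (q * 'X + c%:P).[E1 x y]) *m u =
      c *: u + D1 *m (diag_mx (\row_y q.[E1 x y]) *m u).
    apply/colP=> y; rewrite [RHS]mxE !diag_mulE !mxE hornerD hornerM hornerX hornerC; ring.
  by apply: Plin => //; apply: PD.
- by rewrite mul1mx.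
- by rewrite mulmxDl; apply: Padd; [apply: PB|apply: PB'].
- by rewrite -scalemxAl; apply/PZ/PB.
- by rewrite -mulmxA; apply/PB/PB'.
Qed.

Lemma D1_T : T D1.
Proof.
have -> : D1 = n%:R^-1 *: Astar E x (inord 1).
  by apply/matrixP=> y z; rewrite !mxE mulrnAr mulrA mulVf // mul1r.
exact/inT_scale/inT_star.
Qed.

Lemma adj_E j : adj (E j) = E j.
Proof.
by apply/matrixP => y z; rewrite !mxE (E_conj sch primE) (E_sym sch primE).
Qed.

Lemma adj_T B : T B -> T (adj B).
Proof.
elim=> {B} [B BMB|i||B B' _ TB _ TB'|a B _ TB|B B' _ TB _ TB'].
- by apply: inT_BM; rewrite /adj (BM_tr sch) //; apply: BM_map.
- suff -> : adj (Astar E x i) = Astar E x i by apply: inT_star.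
  apply/matrixP => y z; rewrite !mxE eq_sym.
  by case: eqP => [->|_]; rewrite ?mulr1n ?mulr0n ?rmorph0 // rmorphM /= rmorph_nat (E_conj sch primE).
- by rewrite /adj map_mx1 trmx1; apply: inT_one.
- by rewrite /adj map_mxD linearD; apply: inT_add.
- by rewrite /adj map_mxZ linearZ; apply: inT_scale.
- by rewrite /adj map_mxM trmx_mul; apply: inT_mul.
Qed.

(** Expanding [A i] in the primitive idempotents expands [Estar] in the [Astar] matrices. *)
Lemma Estar_T i : T (Estar C rel x i).
Proof.
have [c cE] := BM_span sch primE (BM_A C rel i).
have -> : Estar C rel x i = \sum_j (c j / n%:R) *: Astar E x j.
  apply/matrixP=> y z; rewrite /Estar cE summxE !mxE.
  rewrite summxE -sumrMnl; apply: eq_bigr => j _.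
  by rewrite !mxE -[X in _ = _ * X]mulrnAr mulrA divfK // mulrnAr.
elim/big_rec: _ => [|j B _ TB]; last by apply/inT_add/TB/inT_scale/inT_star.
by rewrite -(scale0r 1%:M); apply/inT_scale/inT_one.
Qed.

Lemma A1_support (a : 'cV[C]_n) m : (forall y, (m < d x y)%N -> a y 0 = 0) ->
  forall y, (m.+1 < d x y)%N -> (A1 *m a) y 0 = 0.
Proof.
move=> a0 y lt_m; rewrite mxE big1 // => z _; rewrite mxE (adjE rel Dgt0).
case: eqP => [yz|_]; last exact: mul0r.
rewrite a0 ?mulr0 // -ltnS (leq_trans lt_m) //.
by apply: (dist_adj Dgt0 sch met); rewrite (dist_sym sch).
Qed.

(** Dual of [A1_support]: by [E_Astar_E], multiplication by [D1] lowers the index of an eigenspace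
    by at most one. *)
Lemma D1_high (b : 'cV[C]_n) m : (forall h : 'I_D.+1, (h <= m.+1)%N -> E h *m b = 0) ->
  forall h : 'I_D.+1, (h <= m)%N -> E h *m (D1 *m b) = 0.
Proof.
move=> b0 h le_hm; rewrite -[b]mul1mx -(sum_E sch primE) mulmx_suml !mulmx_sumr.
apply: big1 => l _; have [le_lm|lt_ml] := leqP l m.+1.
  by rewrite b0 // !mulmx0.
rewrite -(E_idem primE l) -mulmxA mulmxA mulmxA.
by rewrite (E_Astar_E Dgt0 sch primE comet) ?mul0mx // (leq_trans _ lt_ml).
Qed.

(* [w] lies in the sum of the [E*_i V] with [i <= m] and the [E_h V] with [h > l]. *)
Definition split_at m l (w : 'cV[C]_n) : Prop := exists a : 'cV[C]_n,
  (forall y, (m < d x y)%N -> a y 0 = 0) /\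
  (forall h : 'I_D.+1, (h <= l)%N -> E h *m (w - a) = 0).

Lemma split_at_lin m l k u v : split_at m l u -> split_at m l v -> split_at m l (k *: u + v).
Proof.
move=> [a [a0 ua]] [b [b0 vb]]; exists (k *: a + b); split=> [y lt_m|h le_hl].
  by rewrite !mxE a0 // b0 // mulr0 addr0.
have -> : k *: u + v - (k *: a + b) = k *: (u - a) + (v - b).
  by apply/matrixP => y z; rewrite !mxE; ring.
by rewrite mulmxDr -scalemxAr ua // vb // scaler0 addr0.
Qed.

Let entry_comb k (u a b : 'cV[C]_n) y :
  (u - k *: a + k *: b) y 0 = u y 0 - k * a y 0 + k * b y 0.
Proof. by rewrite !mxE. Qed.

(** Write [A1 w] as [(A1 - k) w + k w] with [k] the eigenvalue on [E_(l+1) V]. The first summand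
    uses the split at [(m, l)]: [A1 - k] kills the component in [E_(l+1) V] and enlarges supports by
    one step. The second uses the split at [(m+1, l+1)]. *)
Lemma split_at_A1 m l w : split_at m l w -> split_at m.+1 l.+1 w ->
  split_at m.+1 l.+1 (A1 *m w).
Proof.
have [th thE] := BM_eig sch primE (BM_A C rel (inord 1)).
pose k := th (inord l.+1).
move=> [a [a0 wa]] [b [b0 wb]]; exists (A1 *m a - k *: a + k *: b); split=> [y lt_m|h le_hl].
  by rewrite entry_comb (@A1_support a m) // a0 1?ltnW // b0 // !mulr0 subr0 addr0.
have -> : A1 *m w - (A1 *m a - k *: a + k *: b) = A1 *m (w - a) - k *: (w - a) + k *: (w - b).
  by rewrite mulmxBr; apply/matrixP => y z; rewrite !mxE; ring.
rewrite mulmxDr mulmxBr -!scalemxAr wb // scaler0 addr0 mulmxA (thE h).2 -scalemxAl -scalerBl.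
case: (ltngtP h l.+1) le_hl => // [lt_hl|eq_hl] _; first by rewrite wa ?scaler0.
by rewrite /k -eq_hl inord_val subrr scale0r.
Qed.

(** Dual argument: [k] is the value of [E_1] at distance [m+1], so [D1 - k] kills the part of [a] at
    that distance, while the eigenspace bound drops by one. *)
Lemma split_at_D1 m l w : split_at m.+1 l.+1 w -> split_at m l w ->
  split_at m l (D1 *m w).
Proof.
have [c cE] := (inBM_P rel E1).1 (E_BM primE _).
pose k := c (inord m.+1).
move=> [a [a0 wa]] [b [b0 wb]]; exists (D1 *m a - k *: a + k *: b); split=> [y lt_m|h le_hl].
  rewrite entry_comb diag_mulE b0 // mulr0 addr0 mxE cE.
  have [lt_m1|] := ltnP m.+1 (d x y); first by rewrite a0 // !mulr0 subr0.
  move=> le_m1; suff -> : rel x y = inord m.+1 by rewrite subrr.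
  by apply: val_inj; have ltd := ltn_ord (rel x y); rewrite /= inordK; lia.
have -> : D1 *m w - (D1 *m a - k *: a + k *: b) = D1 *m (w - a) - k *: (w - a) + k *: (w - b).
  by rewrite mulmxBr; apply/matrixP => y z; rewrite !mxE; ring.
rewrite mulmxDr mulmxBr -!scalemxAr wb // wa 1?ltnW // !scaler0 subr0 addr0.
exact: (@D1_high (w - a) l).
Qed.

(** Orthogonality to the primary module: the vectors [A i *m hatv x] span it, and [A i] is real and
    symmetric. *)
Definition primary_perp (v : 'cV[C]_n) : Prop := forall i, (A i *m v) x 0 = 0.

(** Multiplying [A i] by [A_1] stays in the Bose-Mesner algebra, and [D1] is scalar on each sphere
    around [x]. *)
Lemma primary_perp_T B v : T B -> primary_perp v -> primary_perp (B *m v).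
Proof.
move=> TB; move: B TB v; apply: T_stable => [a u v u0 v0 i|u u0 i|u u0 i].
- by rewrite mulmxDr -scalemxAr 2!mxE u0 v0 mulr0 addr0.
- have [c cE] := BM_mul sch (BM_A C rel i) (BM_A C rel (inord 1)).
  rewrite mulmxA cE mulmx_suml summxE big1 // => k _.
  by rewrite -scalemxAl mxE u0 mulr0.
- have [c cE] := (inBM_P rel E1).1 (E_BM primE _).
  have -> : (A i *m (D1 *m u)) x 0 = c i * (A i *m u) x 0.
    rewrite [LHS]mxE [X in _ * X]mxE mulr_sumr; apply: eq_bigr => y _.
    rewrite diag_mulE mxE mxE cE; case: eqP => [->|_]; last by rewrite !mul0r mulr0.
    by rewrite !mul1r.
  by rewrite u0 mulr0.
Qed.

(* Take an irreducible [W] inside [T u]; it is not orthogonal to [u].  The vectors of [W] that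
   are split at [(r + j, rs + j)] for all [j] form a submodule containing [E*_r W], hence all
   of [W]; but [u] is orthogonal to every vector split at [(t, delta)]. *)
Lemma module_vanish (delta : 'I_D.+1) t (u : 'cV[C]_n) :
  (forall (W : {vspace 'cV[C]_n}) (r rs : 'I_D.+1),
     irr_Tmodule rel E x W -> r_is rel x W r -> rstar_is E W rs ->
     (1 <= rs <= delta)%N -> (r <= rs)%N) ->
  (delta <= t)%N -> E delta *m u = u -> (forall y, (d x y <= t)%N -> u y 0 = 0) ->
  primary_perp u -> u = 0.
Proof.
move=> thin le_dt Eu u_low u_perp; apply/eqP/negPn/negP => nzu.
apply: (@vspace_of_pred _ _ (fun v => exists2 B, T B & v = B *m u)).
- by exists 0; [rewrite -(scale0r 1%:M); apply/inT_scale/inT_one | rewrite mul0mx].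
- move=> a _ _ [B TB ->] [B' TB' ->]; exists (a *: B + B'); first exact/inT_add/TB'/inT_scale.
  by rewrite mulmxDl scalemxAl.
case=> S SP.
apply: (@ex_minimal_vspace _ _ (fun W => [/\ Tmodule rel E x W, W != 0%VS & (W <= S)%VS])).
  exists S; split=> //.
    by move=> B w TB /SP[B' TB' ->]; apply/SP; exists (B *m B'); [apply: inT_mul | rewrite mulmxA].
  apply: contraNneq nzu => S0; rewrite -memv0 -S0; apply/SP.
  by exists 1%:M; [apply: inT_one | rewrite mul1mx].
case=> W [TW nzW sWS] minW.
have irrW : irr_Tmodule rel E x W.
  split=> // U TU sUW; have [->|nzU] := eqVneq U 0%VS; [by left | right].
  by apply: minW => //; split=> //; apply: subv_trans sWS.
have WP w : w \in W -> exists2 B, T B & w = B *m u by move=> Ww; apply/SP/(subvP sWS).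
have [w Ww nzw] : exists2 w, w \in W & w != 0.
  by exists (vpick W); rewrite ?memv_pick ?vpick0.
have [B TB wE] := WP w Ww.
(* As [w = B u], the inner product of [u] with [w0] is the squared norm of [w], which is nonzero. *)
pose w0 := adj B *m w.
have Ww0 : w0 \in W by apply/TW/Ww/adj_T.
have nz_uw0 : dot u w0 != 0.
  by rewrite dot_adj adjK -wE; apply: contraNneq nzw => /dot_eq0->.
have uE v : dot u v = dot u (E delta *m v) by rewrite dot_adj adj_E Eu.
have nzEw0 : E delta *m w0 != 0.
  apply: contraNneq nz_uw0 => Ew0; rewrite uE Ew0.
  by apply/eqP/big1 => y _; rewrite mxE mulr0.
apply: (@ex_least _ (fun j => exists2 w, w \in W & E j *m w != 0) delta); first by exists w0.
case=> rs rsP; have [_ rs_min] := rsP.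
have [y nz_wy] : exists y, w y 0 != 0.
  apply/existsP; apply: contraNT nzw => /existsPn w0'; apply/eqP/colP => y.
  by rewrite mxE; apply/eqP; rewrite -[_ == _]negbK w0'.
apply: (@ex_least _ (fun i => exists2 w, w \in W & Estar C rel x i *m w != 0) (rel x y)).
  exists w => //; apply: contraNneq nz_wy => /colP/(_ y).
  by rewrite diag_mulE !mxE eqxx mul1r => ->.
case=> r rP; have [[w1 Ww1 nzw1] _] := rP.
(* A vector in the image of [E_0] is constant, and orthogonality to the primary module makes its
   value at [x] zero. *)
have rs_gt0 : (0 < rs)%N.
  rewrite lt0n; apply/eqP => rs0; have [[w2 /WP[B2 TB2 ->]]] := rsP.
  have -> : rs = ord0 by apply: val_inj.
  case/eqP; apply/colP => z; rewrite [RHS]mxE.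
  have -> : (E ord0 *m (B2 *m u)) z 0 = (E ord0 *m (B2 *m u)) x 0.
    by rewrite !mxE; apply: eq_bigr => v _; rewrite !(E_0 primE).
  have [c ->] := E_BM primE ord0.
  rewrite mulmx_suml summxE big1 // => i _; rewrite -scalemxAl mxE.
  by rewrite (primary_perp_T TB2) ?mulr0.
have rs_le : (rs <= delta)%N.
  by rewrite leqNgt; apply/negP => /rs_min; apply; exists w0.
have r_le : (r <= rs)%N by apply: thin irrW rP rsP _; rewrite rs_gt0.
pose Zp v := v \in W /\ forall j, split_at (r + j) (rs + j) v.
have Zlin a v v' : Zp v -> Zp v' -> Zp (a *: v + v').
  move=> [Wv vP] [Wv' vP']; split=> [|j]; last exact: split_at_lin.
  by rewrite rpredD ?rpredZ.
have Zlow v : v \in W -> (forall y, d x y != r -> v y 0 = 0) -> Zp v.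
  move=> Wv v0; split=> // j; exists v; split=> [z lt_r|h _]; last by rewrite subrr mulmx0.
  by rewrite v0 // gtn_eqF // (leq_ltn_trans _ lt_r) ?leq_addr.
apply: (vspace_of_pred _ Zlin); first by apply: Zlow => [|z _]; rewrite ?mem0v ?mxE.
case=> Z ZP.
have TZ : Tmodule rel E x Z.
  move=> B' v TB' /ZP Zv; apply/ZP; move: B' TB' v Zv; apply: (T_stable Zlin) => v [Wv vP].
    split=> [|j]; first by apply: TW Wv; apply/inT_BM/BM_A.
    case: j => [|j]; last by rewrite !addnS; apply: split_at_A1; rewrite -?addnS; apply: vP.
    (* At [j = 0] there is no earlier split to use. Here [A1 v] is split by [th rs *: a]: the error
       in [E h] is [th h - th rs] times [E h *m v], which vanishes for [h = rs] and, by minimality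
       of [rs], for [h < rs]. *)
    rewrite !addn0; have [th thE] := BM_eig sch primE (BM_A C rel (inord 1)).
    have [a []] := vP 0%N; rewrite !addn0 => a0 va.
    exists (th rs *: a); split=> [z /a0 az|h le_h]; first by rewrite mxE az mulr0.
    rewrite mulmxBr mulmxA (thE h).2 -scalemxAl -scalemxAr.
    have /eqP := va h le_h; rewrite mulmxBr subr_eq0 => /eqP <-.
    rewrite -scalerBl; move: le_h; rewrite leq_eqVlt => /predU1P[/val_inj->|lt_h].
      by rewrite subrr scale0r.
    have [->|nzh] := eqVneq (E h *m v) 0; first by rewrite scaler0.
    by case: (rs_min h lt_h); exists v.
  split=> [|j]; first by apply: TW Wv; apply: D1_T.
  by apply: split_at_D1 (vP j); rewrite -!addnS.
have ZW : Z = W.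
  case: irrW => _ _ /(_ Z TZ)[|Z0|//]; first by apply/subvP => v /ZP[].
  have : Estar C rel x r *m w1 \in Z.
    apply/ZP/Zlow => [|z ne_z]; first by apply: TW Ww1; apply: Estar_T.
    by rewrite diag_mulE !mxE -val_eqE /= (negbTE ne_z) mul0r.
  by rewrite Z0 memv0 (negbTE nzw1).
(* With this [j], the part [a] lives within distance [r + delta - rs], at most [delta] and so at
   most [t], where [u] vanishes; [E delta] kills the remainder. *)
have /ZP[_ /(_ (delta - rs)%N)[a [a0 wa]]] : w0 \in Z by rewrite ZW.
case/eqP: nz_uw0; rewrite -[w0](subrK a) dotDr uE wa; last by rewrite subnKC.
rewrite /dot !big1 ?addr0 // => z _; last by rewrite mxE mulr0.
have [le_t|lt_t] := leqP (d x z) t; first by rewrite u_low // rmorph0 mul0r.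
by rewrite a0 ?mulr0 //; apply: leq_ltn_trans lt_t; lia.
Qed.

End Terwilliger.

(** * From relative codesigns to proportional columns *)

Section Codesign.

Variables (C : numClosedFieldType) (n D : nat) (rel : 'I_n -> 'I_n -> 'I_D.+1).
Variable E : 'I_D.+1 -> 'M[C]_n.
Hypotheses (Dgt0 : (0 < D)%N) (sch : sym_assoc_scheme rel) (primE : prim_idems rel E).
Hypotheses (met : metric rel) (comet : cometric E).

Local Notation A i := (Amx C rel i).
Local Notation d x y := (nat_of_ord (rel x y)).

Lemma mul_hatv (B : 'M[C]_n) x y : (B *m hatv C x) y 0 = B y x.
Proof.
rewrite mxE (bigD1 x) //= mxE eqxx mulr1 big1 ?addr0 // => z ne_z.
by rewrite mxE (negbTE ne_z) mulr0.
Qed.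

Lemma mul_chi (B : 'M[C]_n) (Y : {set 'I_n}) z : (B *m chi C Y) z 0 = \sum_(y in Y) B z y.
Proof.
rewrite mxE [RHS]big_mkcond; apply: eq_bigr => y _; rewrite mxE.
by case: (y \in Y); rewrite ?mulr1 ?mulr0.
Qed.

Lemma rel_codesign_const x t (psi : 'cV[C]_n) y y' : rel_codesign rel x t psi ->
  (d x y <= t)%N -> rel x y = rel x y' -> psi y 0 = psi y' 0.
Proof.
move=> cod le_t eq_y.
(* The codesign condition starts at distance 1; the sphere of radius 0 is a single point. *)
have [i0|i_gt0] := posnP (d x y).
  have /eqP xy : x == y by rewrite -(dist_eq0 sch) i0.
  have /eqP xy' : x == y' by rewrite -(dist_eq0 sch) -eq_y i0.
  by rewrite -xy -xy'.
have [|a [b [ab0 /colP lin]]] := cod (rel x y); first by rewrite i_gt0.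
have linz z : rel x z = rel x y -> a * psi z 0 + b = 0.
  move=> xz; have := lin z; rewrite mxE [X in X + _]mxE [X in _ + X]mxE mul_hatv.
  by rewrite diag_mulE !mxE (rel_sym sch z) xz eqxx mul1r mulr1.
have nza : a != 0.
  case: ab0 => // nzb; apply/eqP => a0.
  by have /eqP := linz y erefl; rewrite a0 mul0r add0r (negbTE nzb).
by apply: (mulfI nza); apply: (addIr b); rewrite !linz.
Qed.

(** Since [E delta] is a combination of the [A l], its product with [chi C Y] is constant on spheres
    of radius at most [t]. The part [u] orthogonal to the primary module therefore vanishes there,
    and [module_vanish] applies. *)
Lemma codesign_proportional x t (delta : 'I_D.+1) (Y : {set 'I_n}) :
  (forall (W : {vspace 'cV[C]_n}) (r rs : 'I_D.+1),
     irr_Tmodule rel E x W -> r_is rel x W r -> rstar_is E W rs ->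
     (1 <= rs <= delta)%N -> (r <= rs)%N) ->
  (forall l, rel_codesign rel x t (A l *m chi C Y)) -> (delta <= t)%N ->
  exists c, forall z, (E delta *m chi C Y) z 0 = c * E delta z x.
Proof.
move=> thin cod le_dt; pose v := E delta *m chi C Y.
(* This choice gives [u x 0 = 0]. As [u] is an eigenvector of every [A i], it is then orthogonal to
   the primary module. *)
pose c := v x 0 / E delta x x; exists c => z.
pose u := v - c *: (E delta *m hatv C x).
have uE y : u y 0 = v y 0 - c * E delta y x by rewrite /u mxE [X in _ + X]mxE [X in _ - X]mxE mul_hatv.
have Eu : E delta *m u = u.
  by rewrite mulmxBr -scalemxAr !mulmxA (E_idem primE).
have u_perp : primary_perp rel x u.
  move=> i; have [p pE] := BM_eig sch primE (BM_A C rel i).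
  rewrite -Eu mulmxA (pE delta).1 -scalemxAl Eu mxE uE divfK ?subrr ?mulr0 //.
  exact: (E_diag_neq0 sch primE).
have v_const y y' : (d x y <= t)%N -> rel x y = rel x y' -> v y 0 = v y' 0.
  move=> le_t eq_y; have [e eE] := E_BM primE delta.
  rewrite /v eE !mulmx_suml !summxE; apply: eq_bigr => l _.
  by rewrite -scalemxAl mxE [RHS]mxE (rel_codesign_const (cod l) le_t eq_y).
have u_low y : (d x y <= t)%N -> u y 0 = 0.
  move=> le_t; have := u_perp (rel x y).
  have -> : (A (rel x y) *m u) x 0 = u y 0 * #|[set y' | rel x y' == rel x y]|%:R.
    rewrite mxE -sum1dep_card natr_sum mulr_sumr [RHS]big_mkcond; apply: eq_bigr => y' _.
    rewrite mxE; case: eqP => [xy'|_]; rewrite ?mul0r // mul1r mulr1 !uE.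
    rewrite (v_const y y') // (E_rel primE delta (_ : rel y x = rel y' x)) //.
    by rewrite !(rel_sym sch _ x) xy'.
  move/eqP; rewrite mulf_eq0 pnatr_eq0 cards_eq0 => /orP[/eqP //|/eqP/setP/(_ y)].
  by rewrite !inE eqxx.
have /colP/(_ z) : u = 0 by apply: module_vanish Eu u_low u_perp.
by rewrite uE [RHS]mxE => /eqP; rewrite subr_eq0 => /eqP.
Qed.

End Codesign.

(** * Graphs of valency two *)

Section Cycle.

Variables (n D : nat) (rel : 'I_n -> 'I_n -> 'I_D.+1).
Hypotheses (Dgt1 : (1 < D)%N) (sch : sym_assoc_scheme rel) (met : metric rel).

Local Notation d x y := (nat_of_ord (rel x y)).
Local Notation dist_sym := (dist_sym sch).

Let Dgt0 : (0 < D)%N := ltnW Dgt1.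

Hypothesis val2 : forall w a b c,
  d w a = 1%N -> d w b = 1%N -> d w c = 1%N -> [|| a == b, b == c | a == c].

(** One step of a walk without backtracking: the new vertex is at distance 2 from the tail of the
    edge. For [1 < D] the default is not reached along the walk below. *)
Let next (e : 'I_n * 'I_n) : 'I_n * 'I_n :=
  (e.2, odflt e.2 [pick q | (d e.1 q == 2) && (d e.2 q == 1)%N]).

(** The walk is followed to its first repetition, which closes it at its start. All neighbours of
    visited vertices are then visited, and connectedness gives the whole graph. *)
Lemma valency2_cycle : ordinary_cycle rel.
Proof.
have [x0 _] := rel_surj sch ord0.
have [x1 x01] := rel_ex sch x0 (inord 1).
have {}x01 : d x0 x1 = 1%N by rewrite x01 inordK.
pose s k := (iter k next (x0, x1)).1.
have st k : d (s k) (s k.+1) = 1%N /\ d (s k) (s k.+2) = 2%N.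
  have adj_k : d (iter k next (x0, x1)).1 (iter k next (x0, x1)).2 = 1%N.
    elim: k => [|k IHk] //=; case: pickP => [q /andP[_ /eqP] //|noq].
    set e := iter k next _ in IHk noq *.
    have /(dist_up Dgt0 sch met)[q [q2 q1]] : (d e.1 e.2 < D)%N by rewrite IHk.
    by have := noq q; rewrite q1 q2 IHk eqxx.
  split=> //; rewrite /s /=; case: pickP => [q /andP[/eqP] //|noq].
  set e := iter k next _ in adj_k noq *.
  have /(dist_up Dgt0 sch met)[q [q2 q1]] : (d e.1 e.2 < D)%N by rewrite adj_k.
  by have := noq q; rewrite q1 q2 adj_k eqxx.
have s_adj k : d (s k) (s k.+1) = 1%N by case: (st k).
have s_ne2 k : s k != s k.+2.
  by rewrite -(dist_eq0 sch); case: (st k) => _ ->.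
have s_ne1 k : s k != s k.+1 by rewrite -(dist_eq0 sch) s_adj.
have s_nbr k a : d (s k.+1) a = 1%N -> a = s k \/ a = s k.+2.
  move=> sa; have sk : d (s k.+1) (s k) = 1%N by rewrite dist_sym.
  case/or3P: (val2 sa sk (s_adj k.+1)) => /eqP.
  - by left.
  - by move/eqP; rewrite (negbTE (s_ne2 k)).
  - by right.
have exN : exists N, ~~ uniq (mkseq s N.+1).
  exists n; apply/negP => /card_uniqP; rewrite size_mkseq => eqn.
  by have := max_card (mem (mkseq s n.+1)); rewrite eqn card_ord ltnn.
case: (ex_minnP exN) => N nuN minN.
have uN : uniq (mkseq s N).
  case: N minN {nuN} => // N minN; apply/negPn/negP => /minN; rewrite ltnn //.
have s_inj i j : (i < N)%N -> (j < N)%N -> s i = s j -> i = j.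
  move=> ltiN ltjN eqs; apply/eqP; rewrite -(nth_uniq x0 _ _ uN) ?size_mkseq //.
  by rewrite !nth_mkseq // eqs.
have [j0 ltjN sNj] : exists2 j, (j < N)%N & s N = s j.
  have : s N \in mkseq s N.
    by apply: contraNT nuN => sN; rewrite /mkseq -addn1 iotaD map_cat cat_uniq uN /= orbF sN.
  by case/mapP => j; rewrite mem_iota => /andP[_]; exists j.
have Ngt2 : (2 < N)%N.
  case: N ltjN sNj {nuN minN uN s_inj} => [|[|[|N]]] //.
    by case: j0 => // _ /eqP; rewrite eq_sym (negbTE (s_ne1 0%N)).
  case: j0 => [_ /eqP|[_ /eqP|//]]; first by rewrite eq_sym (negbTE (s_ne2 0%N)).
  by rewrite eq_sym (negbTE (s_ne1 1%N)).
have [M NM] : exists M, N = M.+1 by case: (N) Ngt2 => // M; exists M.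
have ltMN : (M < N)%N by rewrite NM.
(* If the walk first returned to [s j.+1], its last new vertex [s M] would be a neighbour of
   [s j.+1], hence [s j] or [s j.+2]; both are ruled out. *)
have sN0 : s N = s 0%N.
  case: j0 ltjN sNj => [//|j] ltjN sNj.
  have [|sMj|sMj] := s_nbr j (s M).
  - by rewrite -sNj dist_sym NM s_adj.
  - have Mj := s_inj M j ltMN (ltnW ltjN) sMj.
    by move: ltjN; rewrite NM Mj ltnn.
  - move: (ltjN); rewrite {1}NM ltnS leq_eqVlt => /predU1P[jM|ltjM].
      by have := s_ne1 M; rewrite -NM sNj -jM eqxx.
    have Mj : M = j.+2 by apply: s_inj => //; rewrite NM ltnS.
    by have := s_ne2 j.+1; rewrite -sNj NM Mj eqxx.
have sN1 : s N.+1 = s 1%N.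
  have [|s1|//] := s_nbr M (s 1%N); first by rewrite -NM sN0.
    have M1 : 1%N = M by apply: s_inj => //; apply: ltnW.
    by move: Ngt2; rewrite NM -M1.
  by rewrite -NM.
have nbr_s i a : (i < N)%N -> d (s i) a = 1%N ->
    a = s i.+1 \/ exists2 j, (j < N)%N & a = s j /\ s j.+1 = s i.
  case: i => [_|i ltiN]; last first.
    by case/s_nbr => [->|->]; [right; exists i => //; apply: ltnW | left].
  rewrite -sN0 NM => /s_nbr[->|->]; last by left; rewrite -NM sN1.
  by right; exists M; rewrite ?NM.
have s_all y : exists2 i, (i < N)%N & y = s i.
  have [m] := ubnP (d (s 0%N) y); elim: m y => // m IHm y; rewrite ltnS leq_eqVlt.
  case/predU1P=> [|/IHm //]; case: m IHm => [|m] IHm dy.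
    by exists 0%N; [apply: ltnW (ltnW Ngt2) | apply/eqP; rewrite eq_sym -(dist_eq0 sch) dy].
  have [z [dz zy]] := dist_step Dgt0 sch met dy.
  have [|i ltiN zi] := IHm z; first by rewrite dz.
  have [|->|[k ltkN [-> _]]] := nbr_s i y ltiN; first by rewrite -zi.
    have [->|neN] := eqVneq i.+1 N; first by exists 0%N; rewrite ?sN0 // (ltnW (ltnW Ngt2)).
    by exists i.+1; rewrite // ltn_neqAle neN.
  by exists k.
have Nn : N = n.
  have /card_uniqP := uN; rewrite size_mkseq => <-.
  rewrite -[RHS]card_ord; apply: eq_card => y; rewrite [RHS]inE.
  by have [i ltiN ->] := s_all y; apply/mapP; exists i; rewrite ?mem_iota.
have s_mod i : (i < n)%N -> s ((i + 1) %% n)%N = s i.+1.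
  rewrite addn1 leq_eqVlt => /predU1P[->|lti]; last by rewrite modn_small.
  by rewrite modnn -sN0 Nn.
exists (fun i => s i); split.
  apply: injF_bij => i j /s_inj; rewrite Nn => /(_ (ltn_ord i) (ltn_ord j)).
  exact: val_inj.
have n_gt0 : (0 < n)%N by rewrite -Nn (ltnW (ltnW Ngt2)).
move=> i j; rewrite (adjE rel Dgt0); apply/eqP/orP => [|[/eqP|/eqP]].
- move=> dij; have [|sj|[k ltk [sj sk]]] := nbr_s i (s j) _ dij; first by rewrite Nn.
    by left; apply/eqP/s_inj; rewrite ?s_mod // Nn ?ltn_pmod.
  rewrite Nn in ltk; right; have -> : nat_of_ord j = k by apply: s_inj; rewrite ?Nn.
  by apply/eqP/s_inj; rewrite ?s_mod // Nn ?ltn_pmod.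
- by move=> <-; rewrite s_mod.
- by move=> <-; rewrite s_mod // dist_sym.
Qed.

End Cycle.

(** * Idempotents with parallel columns *)

Section Imprimitive.

Variables (C : numClosedFieldType) (n D : nat) (rel : 'I_n -> 'I_n -> 'I_D.+1).
Variable E : 'I_D.+1 -> 'M[C]_n.
Hypotheses (Dgt2 : (2 < D)%N) (sch : sym_assoc_scheme rel) (primE : prim_idems rel E).
Hypothesis met : metric rel.

Let Dgt0 : (0 < D)%N := ltnW (ltnW Dgt2).

Local Notation A i := (Amx C rel i).
Local Notation d x y := (nat_of_ord (rel x y)).
Local Notation dist_sym := (dist_sym sch).

(** Equality in Cauchy-Schwarz, as all diagonal entries of [E j] agree: the two columns coincide up
    to sign. The boolean form allows a search for the least such distance. *)
Definition parallel j x y := E j x y * E j x y == E j x x * E j x x.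

Lemma parallelP j x y : reflect
  (exists2 eps, eps * eps = 1 & forall z, E j z y = eps * E j z x) (parallel j x y).
Proof.
have nz := E_diag_neq0 sch primE j x; apply: (iffP eqP) => [sq|[eps eps2 Ey]].
  have Exy : E j x y = E j x y / E j x x * E j x x by rewrite divfK.
  have eps2 : E j x y / E j x x * (E j x y / E j x x) = 1.
    by rewrite mulrACA sq -invfM divff // mulf_neq0.
  by exists (E j x y / E j x x) => //; apply: (E_parallel sch primE eps2 Exy).
by rewrite Ey mulrACA eps2 mul1r.
Qed.

Lemma parallel_rel j x y x' y' : rel x y = rel x' y' -> parallel j x y = parallel j x' y'.
Proof. by move=> eq_rel; rewrite /parallel (E_rel primE j eq_rel) (E_diag sch primE j x x'). Qed.

Lemma parallel_common j x y z : parallel j x y -> parallel j x z -> parallel j y z.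
Proof.
move=> /parallelP[a a2 Ey] /parallelP[b b2 Ez]; apply/parallelP; exists (a * b) => [|w].
  by rewrite mulrACA a2 b2 mul1r.
by rewrite Ez Ey [a * b]mulrC -!mulrA (mulrA a a) a2 mul1r.
Qed.

(** Equal columns at adjacent vertices would make all columns equal by connectedness, contradicting
    orthogonality to [E ord0]. *)
Lemma E_adj_neq j x y : j != ord0 -> d x y = 1%N -> E j x y != E j x x.
Proof.
move=> nz_j dxy; apply: contra_neq nz_j => Exy.
have Eadj u v z : d u v = 1%N -> E j z v = E j z u.
  move=> duv; have relE : rel u v = rel x y by apply: val_inj; rewrite /= duv dxy.
  rewrite (@E_parallel C n D rel E sch primE j u v 1) ?mul1r //.
  by rewrite (E_rel primE j relE) Exy; apply: (E_diag sch primE).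
have Econst u v z : E j z v = E j z u.
  have [m] := ubnP (d u v); elim: m v => // m IHm v; rewrite ltnS leq_eqVlt.
  case/predU1P=> [duv|/IHm //]; case: m IHm duv => [|m] IHm duv.
    by have /eqP -> : u == v by rewrite -(dist_eq0 sch) duv.
  have [w [duw dwv]] := dist_step Dgt0 sch met duv.
  by rewrite (Eadj w v) // IHm // duw.
apply/eqP/negPn/negP => nz_j; have /matrixP/(_ x x) := E_orth sch primE nz_j.
rewrite mxE [RHS]mxE; under eq_bigr => z _ do rewrite (E_0 primE) (Econst x z x).
rewrite sumr_const card_ord -mulrnAr -mulr_natr mulVf ?mulr1 => [/eqP|].
  by rewrite (negbTE (E_diag_neq0 sch primE j x)).
by rewrite pnatr_eq0 -lt0n (leq_ltn_trans _ (ltn_ord x)).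
Qed.

Variable j : 'I_D.+1.
Hypothesis nz_j : j != ord0.

Lemma parallel_adj_dist x y z : parallel j x y -> d y z = 1%N -> d x z != d x y.
Proof.
move=> /parallelP[eps eps2 Ey] dyz; apply/eqP => eq_d.
have := E_adj_neq nz_j dyz; rewrite (E_sym sch primE) Ey (E_sym sch primE).
have -> : E j x z = E j x y by apply: (E_rel primE); apply: val_inj.
by rewrite Ey mulrA eps2 mul1r (E_diag sch primE j x y) eqxx.
Qed.

(* If [E_j] has parallel columns at a distance strictly between [0] and [D], take the
   least such distance [i]; then [a_i = 0], and unless [i = 1] every vertex has at most
   two neighbours. *)
Lemma parallel_bipartite_or_valency2 x0 y0 : x0 != y0 -> (d x0 y0 < D)%N -> parallel j x0 y0 ->
  (forall x y, d x y = 1%N -> E j x y = - E j x x) \/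
  (forall w a b c, d w a = 1%N -> d w b = 1%N -> d w c = 1%N -> [|| a == b, b == c | a == c]).
Proof.
move=> ne0 ltD par0.
have exi : exists k, [exists x, exists y, [&& d x y == k, x != y & parallel j x y]].
  by exists (d x0 y0); apply/existsP; exists x0; apply/existsP; exists y0; rewrite eqxx ne0.
case: (ex_minnP exi) => i /existsP[xi /existsP[yi /and3P[/eqP dxyi nei pari]]] mini.
have par_i x y : d x y = i -> parallel j x y.
  by move=> dxy; rewrite (@parallel_rel j _ _ xi yi) //; apply: val_inj; rewrite /= dxy.
have par_min x y : parallel j x y -> (d x y < i)%N -> x = y.
  move=> pxy lti; apply/eqP/negPn/negP => nexy; move: lti; rewrite ltnNge mini //.
  by apply/existsP; exists x; apply/existsP; exists y; rewrite eqxx nexy.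
have i_gt0 : (0 < i)%N by rewrite -dxyi lt0n (dist_eq0 sch).
have ltiD : (i < D)%N.
  apply: leq_ltn_trans ltD; apply: mini.
  by apply/existsP; exists x0; apply/existsP; exists y0; rewrite eqxx ne0.
have ai0 x y z : d x y = i -> d y z = 1%N -> d x z != i.
  by move=> dxy dyz; rewrite -[X in _ != X]dxy; apply: parallel_adj_dist dyz; apply: par_i.
have tri x y z : d y z = 1%N -> (d x z <= (d x y).+1)%N.
  exact: (dist_adj Dgt0 sch met).
have [i1|] := leqP i 1.
  left=> x y dxy; have [|eps eps2 Ey] := parallelP _ _ _ (par_i x y _).
    by rewrite dxy; apply/eqP; rewrite eqn_leq i1 i_gt0.
  have /eqP : (eps - 1) * (eps + 1) = 0 by rewrite mulrDr mulrBl; ring: eps2.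
  rewrite mulf_eq0 subr_eq0 addr_eq0 => /orP[]/eqP eps1; last by rewrite Ey eps1 mulN1r.
  by have := E_adj_neq nz_j dxy; rewrite Ey eps1 mul1r eqxx.
have ne_adj u v : d u v = 1%N -> u != v by move=> duv; rewrite -(dist_eq0 sch) duv.
have nbr2 w a b : d w a = 1%N -> d w b = 1%N -> (d a b <= 2)%N.
  by move=> wa wb; apply: leq_trans (tri _ _ _ wb) _; rewrite dist_sym wa.
rewrite leq_eqVlt => /predU1P[/esym i2|i_gt2]; last first.
  (* Two neighbours of [y] equally far from [x] are shown to be at distance [i] from a common [x'].
     They are then parallel at distance at most 2, less than [i], so equal. *)
  right; have U x y z z' : d x y = i -> d y z = 1%N -> d y z' = 1%N -> d x z = d x z' -> z = z'.
    move=> dxy dyz dyz' dxz.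
    suff [x' [dz dz']] : exists x', d x' z = i /\ d x' z' = i.
      apply: par_min (leq_ltn_trans (nbr2 y _ _ dyz dyz') i_gt2).
      by apply: (@parallel_common j x'); apply: par_i.
    have ne_i := ai0 x y z dxy dyz.
    have [le_i|lt_i] := leqP (d x z) i.
      have {ne_i} lt_i : (d x z < i)%N by rewrite ltn_neqAle ne_i.
      have /(dist_up Dgt0 sch met)[x' [dyx' xx']] : (d y x < D)%N by rewrite dist_sym dxy.
      rewrite (dist_sym y x) dxy in dyx'.
      have dx' v : d x v = d x z -> d y v = 1%N -> d x' v = i.
        move=> dxv dyv; have h1 : (d x' v <= (d x v).+1)%N.
          by rewrite (dist_sym x') (dist_sym x); apply: tri.
        have h2 : (d x' y <= (d x' v).+1)%N by apply: tri; rewrite dist_sym.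
        rewrite dist_sym dyx' in h2; rewrite dxv in h1; lia.
      by exists x'; rewrite !dx'.
    have [x' [dyx' xx']] : exists x', d y x' = i.-1 /\ d x' x = 1%N.
      by apply: (dist_step Dgt0 sch met); rewrite dist_sym dxy prednK.
    have dx' v : d x v = d x z -> d y v = 1%N -> d x' v = i.
      move=> dxv dyv; have h1 := tri x' y v dyv.
      have h2 : (d x v <= (d x' v).+1)%N.
        by rewrite (dist_sym x') (dist_sym x); apply: tri.
      rewrite (dist_sym x' y) dyx' in h1; rewrite dxv in h2; lia.
    by exists x'; rewrite !dx'.
  move=> w a b c wa wb wc; have [x wx] := rel_ex sch w (inord i).
  have dxw : d x w = i by rewrite dist_sym wx inordK // ltnW.
  have rng v : d w v = 1%N -> d x v = i.-1 \/ d x v = i.+1.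
    move=> wv; have := tri x w v wv; have := ai0 x w v dxw wv.
    have := tri x v w; rewrite (dist_sym v) wv dxw => /(_ erefl); lia.
  have Uw := U x w _ _ dxw.
  case: (rng a wa) (rng b wb) (rng c wc) => da [] db [] dc.
  - by rewrite (Uw a b) ?eqxx ?da ?db.
  - by rewrite (Uw a b) ?eqxx ?da ?db.
  - by rewrite (Uw a c) ?eqxx ?orbT ?da ?dc.
  - by rewrite (Uw b c) ?eqxx ?orbT ?db ?dc.
  - by rewrite (Uw b c) ?eqxx ?orbT ?db ?dc.
  - by rewrite (Uw a c) ?eqxx ?orbT ?da ?dc.
  - by rewrite (Uw a b) ?eqxx ?da ?db.
  - by rewrite (Uw a b) ?eqxx ?da ?db.
(* Now [i = 2]. A triangle would yield a vertex [v] at distance 2 from both ends of an edge,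
   contradicting [ai0]. *)
have no_triangle w y s : d w y = 1%N -> d w s = 1%N -> d s y != 1%N.
  move=> wy ws; apply/eqP => sy.
  have /(dist_up Dgt0 sch met)[x [yx wx]] : (d y w < D)%N.
    by rewrite dist_sym wy (leq_trans _ Dgt2).
  rewrite (dist_sym y w) wy (dist_sym y x) in yx.
  have /(dist_up Dgt0 sch met)[v [xv yv]] : (d x y < D)%N by rewrite yx.
  rewrite yx in xv.
  have vw : d v w = i.
    have := tri w y v yv; have := tri v w x wx.
    rewrite i2 wy !(dist_sym v) xv; lia.
  have xs : d x s = 1%N.
    have := ai0 x y s; rewrite i2 yx dist_sym sy => /(_ erefl erefl).
    have := tri x w s ws; rewrite (dist_sym x w) wx.
    have : x != s by apply: contra_eq_neq yx => ->; rewrite sy.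
    by rewrite -(dist_eq0 sch); case: (d x s) => [|[|[|]]].
  have vs : d v s = i.
    have := tri s y v yv; have := tri v s x; rewrite i2 sy !(dist_sym v) xv (dist_sym s) xs; lia.
  by have := ai0 v w s vw ws; rewrite vs eqxx.
have nbr_par w a b : d w a = 1%N -> d w b = 1%N -> a != b -> d a b = i.
  move=> wa wb neab; have := nbr2 w a b wa wb; rewrite leq_eqVlt i2 => /predU1P[//|].
  rewrite ltnS leq_eqVlt => /predU1P[ab|]; last by rewrite ltnS leqn0 (dist_eq0 sch) (negbTE neab).
  by have := no_triangle w b a wb wa; rewrite ab.
have [eps eps2 Ei] : exists2 eps, eps * eps = 1 &
    forall u v, d u v = i -> forall z, E j z v = eps * E j z u.
  have [eps eps2 Eyi] := parallelP _ _ _ pari; exists eps => // u v duv.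
  apply: (E_parallel sch primE eps2).
  rewrite (E_rel primE j (_ : rel u v = rel xi yi)) ?Eyi; last by apply: val_inj; rewrite /= duv.
  by congr (_ * _); apply: (E_diag sch primE).
have /eqP : (eps - 1) * (eps + 1) = 0 by rewrite mulrDr mulrBl; ring: eps2.
(* With sign [-1], three neighbours of a vertex would have pairwise opposite columns, which is
   impossible. *)
rewrite mulf_eq0 subr_eq0 addr_eq0 => /orP[]/eqP eps1; last first.
  right=> w a b c wa wb wc; apply/negPn/negP; rewrite !negb_or => /and3P[ab bc ac].
  have := Ei a c (nbr_par w a c wa wc ac) a.
  rewrite (Ei b c (nbr_par w b c wb wc bc)) (Ei a b (nbr_par w a b wa wb ab)) eps1.
  rewrite !mulN1r opprK => /eqP; rewrite -addr_eq0 -mulr2n mulrn_eq0 /=.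
  by rewrite (negbTE (E_diag_neq0 sch primE j a)).
(* With sign [+1], all neighbours of [xi] share one column. The eigenvalue equation makes it
   proportional to column [xi], so adjacent vertices are parallel, against the minimality of [i]. *)
have [th thE] := BM_eig sch primE (BM_A C rel (inord 1)).
exfalso; have [a wa] := rel_ex sch xi (inord 1).
have {}wa : d xi a = 1%N by rewrite wa inordK // ltnS.
pose k : C := #|[set b | d xi b == 1%N]|%:R.
have kE z : k * E j z a = th j * E j z xi.
  have /matrixP/(_ z xi) := (thE j).2; rewrite [RHS]mxE => <-.
  rewrite mxE /k -sum1dep_card natr_sum mulr_suml big_mkcond; apply: eq_bigr => b _.
  rewrite mxE (adjE rel Dgt0) dist_sym; case: eqP => [wb|_]; last by rewrite mulr0.
  rewrite dist_sym in wb; rewrite mul1r mulr1; have [->//|neab] := eqVneq a b.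
  by rewrite (Ei a b (nbr_par xi a b wa wb neab)) eps1 mul1r.
have nzk : k != 0.
  rewrite pnatr_eq0 cards_eq0; apply/eqP => /setP/(_ a).
  by rewrite !inE wa eqxx.
have := par_min xi a; rewrite wa => par_xia.
have : xi = a.
  apply: par_xia; last by rewrite i2.
  apply/eqP/(mulfI nzk); have Exx := kE xi; have Eaa := kE a.
  rewrite (E_diag sch primE j a xi) (E_sym sch primE j a) in Eaa.
  by rewrite [LHS]mulrA Exx mulrAC -Eaa; ring.
by move/eqP; rewrite (negbTE (ne_adj _ _ wa)).
Qed.

End Imprimitive.

(** * Antipodal pairs and bipartite halves *)

Section Conclusion.

Variables (C : numClosedFieldType) (n D : nat) (rel : 'I_n -> 'I_n -> 'I_D.+1).
Variable E : 'I_D.+1 -> 'M[C]_n.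
Hypotheses (Dgt2 : (2 < D)%N) (sch : sym_assoc_scheme rel) (primE : prim_idems rel E).
Hypotheses (met : metric rel) (comet : cometric E).

Let Dgt0 : (0 < D)%N := ltnW (ltnW Dgt2).

Local Notation A i := (Amx C rel i).
Local Notation E1 := (E (inord 1)).
Local Notation d x y := (nat_of_ord (rel x y)).
Local Notation dist_sym := (dist_sym sch).
Local Notation parallel := (parallel E).

(** For [0 < j < D], both [E_(j-1)] and [E_(j+1)] occur in the entrywise product of [E_1] and [E j].
    Alternation gives both the [A_1]-eigenvalue opposite to that of [E_1], but these eigenvalues are
    distinct. *)
Lemma E_alternating_last (j : 'I_D.+1) : j != ord0 ->
  (forall x y, d x y = 1%N -> E j x y = - E j x x) -> j = ord_max.
Proof.
move=> nz_j alt; apply/eqP/negPn/negP => ne_jD.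
have alt_col x y z : d x y = 1%N -> E j x z = - E j y z.
  move=> dxy; rewrite (E_sym sch primE j x) (E_sym sch primE j y) -mulN1r.
  apply: (E_parallel sch primE); first by rewrite mulrNN mulr1.
  by rewrite mulN1r -(alt y x) // dist_sym.
have [th thE] := BM_eig sch primE (BM_A C rel (inord 1)).
have [c [cE _ c_top]] := E1_had Dgt0 sch primE comet j.
have neg_eig l : c l != 0 -> th l = - th (inord 1).
  move=> nz_cl; pose F : 'M[C]_n := \matrix_(x, y) (E1 x y * E j x y).
  have FE : F = \sum_l c l *: E l by apply/matrixP=> x y; rewrite mxE cE.
  have AF : A (inord 1) *m F = - th (inord 1) *: F.
    apply/matrixP => x y; rewrite [RHS]mxE [in RHS]mxE.
    have /matrixP/(_ x y) := (thE (inord 1)).1; rewrite mxE [RHS]mxE => thx.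
    rewrite mulrA mulNr -thx mulNr mulr_suml -sumrN mxE; apply: eq_bigr => z _.
    rewrite !mxE (adjE rel Dgt0); case: eqP => [dxz|_]; last by rewrite !mul0r oppr0.
    by rewrite (alt_col x z) //; ring.
  have : A (inord 1) *m F *m E l = - th (inord 1) *: F *m E l by rewrite AF.
  rewrite -mulmxA -scalemxAl FE (span_mulE sch primE) -scalemxAr (thE l).1 !scalerA.
  move/eqP; rewrite -subr_eq0 -scalerBl scaler_eq0 (negbTE (E_neq0 primE l)) orbF subr_eq0.
  by rewrite mulrC => /eqP /(mulIf nz_cl).
have ltjD : (j < D)%N.
  by rewrite ltn_neqAle -ltnS ltn_ord andbT; apply: contra ne_jD => /eqP jD; apply/eqP/val_inj.
have j_gt0 : (0 < j)%N by rewrite lt0n.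
pose l : 'I_D.+1 := inord j.+1; pose m : 'I_D.+1 := inord j.-1.
have lE : l = j.+1 :> nat by rewrite inordK.
have mE : m = j.-1 :> nat by rewrite inordK // (leq_ltn_trans (leq_pred _)).
(* The triple sum of [E_1], [E j], [E m] is symmetric in [j] and [m]; read from [m], it carries the
   nonzero top coefficient since [j = m+1]. *)
have nz_cm : c m != 0.
  have [c' [cE' _ c_top']] := E1_had Dgt0 sch primE comet m.
  have : c' j * \sum_x E j x x != 0.
    by rewrite mulf_neq0 ?(E_trace_neq0 sch primE) // c_top' // mE prednK.
  rewrite -(sum_had_E sch primE); apply: contra_neq => cm0.
  transitivity (c m * \sum_x E m x x); last by rewrite cm0 mul0r.
  rewrite -(sum_had_E sch primE); apply: eq_bigr => x _; apply: eq_bigr => y _.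
  by rewrite -cE -cE'; ring.
have eq_th : th m = th l by rewrite (neg_eig m nz_cm) (neg_eig l) // c_top.
have : m = l.
  apply: (E_eig_inj Dgt0 sch primE met (thE m).1); rewrite eq_th; exact: (thE l).1.
by move/(congr1 val); rewrite /= mE lE; lia.
Qed.

Variables (Y : {set 'I_n}) (delta : 'I_D.+1).
Hypotheses (nz_delta : delta != ord0) (Y_gt1 : (1 < #|Y|)%N).
Hypothesis design : forall j : 'I_D.+1, j != ord0 -> (j < delta)%N ->
  forall z, \sum_(y in Y) E j z y = 0.

(** [chi C Y] is the constant [#|Y|/n] plus a vector changing sign along edges. If it agreed at
    adjacent vertices, the constant would be 0 or 1. *)
Lemma alternating_half : (#|Y| < n)%N -> delta = ord_max ->
  (forall x y, d x y = 1%N -> E delta x y = - E delta x x) ->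
  forall x y, rel x y = inord 1 -> (x \in Y) != (y \in Y).
Proof.
move=> Y_ltn deltaD alt x y /eqP; rewrite (adjE rel Dgt0) => /eqP dxy.
have nz_n : n%:R != 0 :> C by rewrite pnatr_eq0 -lt0n (leq_ltn_trans _ Y_ltn).
have chiE z : (z \in Y)%:R = #|Y|%:R / n%:R + \sum_(u in Y) E delta z u :> C.
  have : chi C Y z 0 = (\sum_j (E j *m chi C Y)) z 0.
    by rewrite -mulmx_suml (sum_E sch primE) mul1mx.
  rewrite mxE summxE => ->; under eq_bigr do rewrite mul_chi.
  rewrite (bigD1 ord0) //= (bigD1 delta) //= [X in _ + (_ + X)]big1 => [|j /andP[nz_j ne_j]].
    rewrite addr0; congr (_ + _).
    by rewrite (eq_bigr (fun=> n%:R^-1)) ?sumr_const ?mulr_natl // => u _; rewrite (E_0 primE).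
  rewrite design // deltaD ltn_neqAle -ltnS ltn_ord andbT.
  by apply: contra ne_j => /eqP jD; rewrite deltaD; apply/eqP/val_inj.
have alt_sum : \sum_(u in Y) E delta x u = - \sum_(u in Y) E delta y u.
  rewrite -sumrN; apply: eq_bigr => u _; rewrite -mulN1r.
  rewrite (E_sym sch primE delta x) (E_sym sch primE delta y).
  apply: (E_parallel sch primE); first by rewrite mulrNN mulr1.
  by rewrite mulN1r -(alt y x) // dist_sym.
have two : (x \in Y)%:R + (y \in Y)%:R = #|Y|%:R / n%:R + #|Y|%:R / n%:R :> C.
  by rewrite !chiE alt_sum; ring.
apply/eqP => eqY; move: two; rewrite eqY -!mulr2n => /eqP.
rewrite -subr_eq0 -mulrnBl mulrn_eq0 /= subr_eq0 -(inj_eq (mulIf nz_n)) divfK // -natrM.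
rewrite eqr_nat => /eqP cardY; move: Y_gt1 Y_ltn; rewrite -cardY.
by case: (y \in Y); rewrite ?mul1n ?ltnn.
Qed.

Lemma E1_antipode_uniq x y y' : E1 x y = - E1 x x -> E1 x y' = - E1 x x -> y = y'.
Proof.
rewrite -mulN1r => Ey Ey'; have eps2 : -1 * -1 = 1 :> C by rewrite mulrNN mulr1.
have Pz := E_parallel sch primE eps2 Ey; have Pz' := E_parallel sch primE eps2 Ey'.
apply/eqP; rewrite -(rel_eq0 sch) -(rel_xx sch y); apply/eqP.
by apply: (E1_inj sch primE comet); rewrite Pz' -Pz.
Qed.

(** If [delta] were 1, distinct points of [Y] would be antipodes in the [E_1]-embedding. Then [Y]
    has two points and their columns cancel, against a nonzero sum. *)
Lemma dual_degree_gt1 :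
  (exists z, \sum_(y in Y) E delta z y != 0) ->
  (forall x y, x \in Y -> y \in Y -> parallel delta x y) -> (1 < delta)%N.
Proof.
case=> z nz_sum par; rewrite ltn_neqAle lt0n nz_delta andbT; apply: contraNneq nz_sum => delta1.
have {}delta1 : delta = inord 1 by apply: val_inj; rewrite /= inordK.
have [x Yx] : exists x, x \in Y by apply/card_gt0P/ltnW.
have neg y : y \in Y -> y != x -> E1 x y = - E1 x x /\ forall w, E1 w y = - E1 w x.
  move=> Yy ne_yx; have := par x y Yx Yy; rewrite delta1 => /(parallelP sch primE)[eps eps2 Ey].
  have /eqP : (eps - 1) * (eps + 1) = 0 by rewrite mulrDr mulrBl; ring: eps2.
  rewrite mulf_eq0 subr_eq0 addr_eq0 => /orP[]/eqP eps1; last first.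
    by split=> [|w]; rewrite Ey eps1 mulN1r.
  have : rel x y = rel x x by apply: (E1_inj sch primE comet); rewrite Ey eps1 mul1r.
  by rewrite (rel_xx sch) => /eqP; rewrite (rel_eq0 sch) eq_sym (negbTE ne_yx).
have [y Yy ne_yx] : exists2 y, y \in Y & y != x.
  have [y] : exists y, y \in Y :\ x by apply/card_gt0P; move: Y_gt1; rewrite (cardsD1 x) Yx.
  by rewrite !inE => /andP[]; exists y.
rewrite (bigD1 x) //= (bigD1 y) ?Yy //= big1 => [|w /andP[/andP[Yw ne_wx] ne_wy]].
  by rewrite delta1 (neg y Yy ne_yx).2 addr0 subrr.
have := E1_antipode_uniq (neg y Yy ne_yx).1 (neg w Yw ne_wx).1.
by move/eqP; rewrite eq_sym (negbTE ne_wy).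
Qed.

(** The vanishing sum for [E_1] makes points at distance [D] antipodes in the [E_1]-embedding, and
    antipodes there are unique. *)
Lemma antipodal_pair : (1 < delta)%N ->
  (forall x y, x \in Y -> y \in Y -> x != y -> d x y = D) -> #|Y| = 2%N ->
  antipodal_double_cover rel /\ exists x y, Y = [set x; y] /\ rel x y = ord_max.
Proof.
move=> delta_gt1 far /eqP/cards2P[x [y [ne_xy YE]]].
have rel_xy : rel x y = ord_max by apply/val_inj/far; rewrite // YE !inE eqxx ?orbT.
have Exy : E1 x y = - E1 x x.
  have := design (_ : inord 1 != ord0) _ x.
  rewrite YE big_setU1 ?inE //= big_set1 -val_eqE /= inordK // => /(_ isT delta_gt1).
  by move/eqP; rewrite addrC addr_eq0 => /eqP.
have anti u v : rel u v = ord_max -> E1 u v = - E1 u u.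
  by move=> uv; rewrite (E_rel primE _ (_ : rel u v = rel x y)) ?Exy ?(E_diag sch primE _ x u) ?uv.
have uniq u v w : rel u v = ord_max -> rel u w = ord_max -> v = w.
  by move=> /anti uv /anti uw; apply: E1_antipode_uniq uv uw.
split; last by exists x, y.
split=> [u v w|u].
  case/orP=> [/eqP->//|/eqP uv] /orP[/eqP<-|/eqP vw]; first by rewrite uv eqxx orbT.
  by rewrite (uniq v u w) ?eqxx // (rel_sym sch).
have [v uv] := rel_ex sch u ord_max.
have ne_uv : u != v.
  by rewrite -(rel_eq0 sch) uv -val_eqE /= -lt0n.
suff -> : [set z | (u == z) || (rel u z == ord_max)] = [set u; v] by rewrite cards2 ne_uv.
apply/setP => z; rewrite !inE eq_sym; congr (_ || _).
by apply/eqP/eqP => [uz|->//]; apply: uniq uz uv.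
Qed.

Lemma far_card_le2 : (1 < delta)%N ->
  (forall x y, x \in Y -> y \in Y -> parallel delta x y) ->
  (forall x y, x \in Y -> y \in Y -> x != y -> d x y = D) -> (#|Y| <= 2)%N.
Proof.
move=> delta_gt1 par far; rewrite leqNgt; apply/negP => Y_gt2.
have /card_gt2P[x1 [x2 [x3 [[Y1 Y2 Y3] [ne12 ne23 ne31]]]]] := Y_gt2.
have rel_far u v : u \in Y -> v \in Y -> u != v -> rel u v = ord_max.
  by move=> Yu Yv ne_uv; apply/val_inj/far.
have [eps eps2 Eps] : exists2 eps, eps * eps = 1 &
    forall u v, u \in Y -> v \in Y -> u != v -> forall z, E delta z v = eps * E delta z u.
  have [eps eps2 E12] := parallelP sch primE _ _ _ (par x1 x2 Y1 Y2).
  exists eps => // u v Yu Yv ne_uv; apply: (E_parallel sch primE eps2).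
  rewrite (E_rel primE delta (_ : rel u v = rel x1 x2)) ?E12 ?rel_far //.
  by congr (_ * _); apply: (E_diag sch primE).
(* Going around three points multiplies a column by the sign three times. *)
have eps1 : eps = 1.
  have := Eps x2 x3 Y2 Y3 ne23 x3; rewrite (Eps x1 x2 Y1 Y2 ne12) mulrA eps2 mul1r.
  have := Eps x3 x1 Y3 Y1 ne31 x3 => -> E33.
  by apply: (mulIf (E_diag_neq0 sch primE delta x3)); rewrite -E33 mul1r.
have same y z : y \in Y -> E delta z y = E delta z x1.
  by move=> Yy; have [->//|ne] := eqVneq x1 y; rewrite (Eps x1 y) // eps1 mul1r.
have [w x1w] := rel_ex sch x1 (inord 1).
have {}x1w : d x1 w = 1%N by rewrite x1w inordK // ltnS.
(* The triangle inequality leaves [D-1] and [D]; distance [D] would give [E delta] equal values at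
   the edge [x1 w] and on the diagonal. *)
have wy y : y \in Y -> y != x1 -> d w y = D.-1.
  move=> Yy ne; have x1y : d x1 y = D by apply: far; rewrite // eq_sym.
  have h1 : (D <= (d w y).+1)%N.
    rewrite -[X in (X <= _)%N]x1y (dist_sym x1) (dist_sym w); apply: (dist_adj Dgt0 sch met).
    by rewrite dist_sym.
  suff : d w y != D by have := ltn_ord (rel w y); clear -h1; lia.
  apply/eqP => dwy; have := E_adj_neq Dgt2 sch primE met nz_delta x1w.
  rewrite (E_sym sch primE) -(same y w Yy).
  rewrite (E_rel primE delta (_ : rel w y = rel x1 y)) ?(same y x1 Yy) ?eqxx //.
  by apply: val_inj; rewrite /= dwy x1y.
pose r : C := #|Y|.-1%:R.
have sumY (F : 'I_n -> C) : (forall y, y \in Y -> y != x1 -> F y = F x2) ->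
    \sum_(y in Y) F y = F x1 + r * F x2.
  move=> constF; rewrite (bigD1 x1) //=; congr (_ + _).
  rewrite (eq_bigr (fun=> F x2)) => [|y /andP[]]; last exact: constF.
  rewrite sumr_const /r (cardsD1 x1) Y1 add1n /= mulr_natl; congr (_ *+ _).
  by apply: eq_card => y; rewrite !inE andbC.
have ne21 : x2 != x1 by rewrite eq_sym.
have dw2 := wy x2 Y2 ne21.
have E_far j y : y \in Y -> y != x1 -> E j x1 y = E j x1 x2.
  by move=> Yy ne; apply: (E_rel primE); rewrite !rel_far // eq_sym.
have E_w j y : y \in Y -> y != x1 -> E j w y = E j w x2.
  by move=> Yy ne; apply: (E_rel primE); apply: val_inj; rewrite /= !wy.
have sum_far j : \sum_(y in Y) E j x1 y = E j x1 x1 + r * E j x1 x2.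
  by apply: sumY => y; apply: E_far.
have sum_w j : \sum_(y in Y) E j w y = E j w x1 + r * E j w x2.
  by apply: sumY => y; apply: E_w.
have nz1 : inord 1 != ord0 :> 'I_D.+1 by rewrite -val_eqE /= inordK // ltnS.
have lt1 : ((inord 1 : 'I_D.+1) < delta)%N by rewrite inordK // ltnS.
have := design nz1 lt1 w; rewrite sum_w => /eqP; rewrite addr_eq0 => /eqP Ew1.
have := design nz1 lt1 x1; rewrite sum_far => /eqP; rewrite addr_eq0 => /eqP E11.
have ne_far : E1 x1 x2 != E1 w x2.
  apply/eqP => /(E1_inj sch primE comet)/(congr1 val) /=.
  by rewrite dw2 (far x1 x2) //; clear -Dgt2; lia.
have ne_0 : E1 x1 x1 != E1 x1 x2.
  apply/eqP => /(E1_inj sch primE comet); rewrite (rel_xx sch) => /esym/eqP.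
  by rewrite (rel_eq0 sch) (negbTE ne12).
have ne_1 : E1 w x1 != E1 w x2.
  apply/eqP => /(E1_inj sch primE comet)/(congr1 val) /=.
  by rewrite dw2 (dist_sym w) x1w; clear -Dgt2; lia.
have [al [be [ga [nz_ga E2]]]] := E2_quadratic comet (ltnW Dgt2).
have r_neq k : (k < 2)%N -> r != k%:R by move=> ltk; rewrite eqr_nat; clear -Y_gt2 ltk; lia.
(* If [delta = 2], equal values of the quadratic at distinct arguments fix the argument sum in both
   rows. With the relations from [E_1] this forces equality in [ne_far], as [r] is not 1. *)
have [delta2|ne_delta2] := eqVneq delta (inord 2).
  have := same x2 x1 Y2; have := same x2 w Y2; rewrite delta2 !E2.
  set e0 := E1 x1 x1 in E11 ne_0 *; set eD := E1 x1 x2 in E11 ne_0 ne_far *.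
  set e1 := E1 w x1 in Ew1 ne_1 *; set e' := E1 w x2 in Ew1 ne_1 ne_far *.
  move=> eqw eq1.
  have s1 : be + ga * (e1 + e') = 0.
    rewrite -subr_eq0 in ne_1; apply: (mulfI ne_1); rewrite mulr0.
    transitivity ((al + be * e1 + ga * (e1 * e1)) - (al + be * e' + ga * (e' * e'))); first ring.
    by rewrite eqw subrr.
  have s0 : be + ga * (e0 + eD) = 0.
    rewrite -subr_eq0 in ne_0; apply: (mulfI ne_0); rewrite mulr0.
    transitivity ((al + be * e0 + ga * (e0 * e0)) - (al + be * eD + ga * (eD * eD))); first ring.
    by rewrite eq1 subrr.
  case/eqP: ne_far; apply: (mulfI nz_ga).
  have nz_r : 1 - r != 0 by rewrite subr_eq0 eq_sym (r_neq 1%N).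
  apply: (mulfI nz_r); apply: (addrI be).
  have -> : be + (1 - r) * (ga * eD) = be + ga * (e0 + eD) by rewrite E11; ring.
  by rewrite s0 -s1 Ew1; ring.
have nz2 : inord 2 != ord0 :> 'I_D.+1 by rewrite -val_eqE /= inordK // ltnS ltnW.
have lt2 : ((inord 2 : 'I_D.+1) < delta)%N.
  rewrite inordK; last by rewrite ltnS ltnW.
  rewrite ltn_neqAle delta_gt1 andbT.
  by apply: contra ne_delta2 => /eqP->; rewrite inord_val.
have := design nz2 lt2 w; rewrite sum_w !E2.
have := design nz2 lt2 x1; rewrite sum_far !E2 E11 Ew1 => q0 q1.
have nz_coef : ga * (r * (1 + r)) != 0.
  by rewrite !mulf_neq0 // ?(r_neq 0%N) // -[1]/(1%:R) -natrD pnatr_eq0.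
(* Now [E_2] also sums to zero over [Y]. The linear terms cancel by the [E_1] relations, and
   subtracting the two rows leaves the difference of squares. *)
have /eqP : (E1 x1 x2 - E1 w x2) * (E1 x1 x2 + E1 w x2) = 0.
  by apply: (mulfI nz_coef); rewrite mulr0 -[RHS](subrr 0) -{1}q0 -q1; ring.
rewrite mulf_eq0 subr_eq0 (negbTE ne_far) addr_eq0 /= => /eqP eDw.
have E1w : E1 w x1 = - E1 w w by rewrite (E_diag sch primE _ w x1) E11 eDw Ew1; ring.
(* [x1] is the [E_1]-antipode of its neighbour [w], and so is any other neighbour [q] of [w],
   against uniqueness. *)
have /(dist_up Dgt0 sch met)[q [x1q wq]] : (d x1 w < D)%N by rewrite x1w (leq_trans _ Dgt2).
have : x1 = q.
  apply: (E1_antipode_uniq E1w); rewrite -E1w; apply: (E_rel primE).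
  by apply: val_inj; rewrite /= wq dist_sym.
by move/eqP; rewrite -(dist_eq0 sch) x1q.
Qed.

End Conclusion.

(** * The three alternatives *)

Unset Implicit Arguments.

Theorem theorem6p3 (C : numClosedFieldType) (n D : nat)
  (rel : 'I_n -> 'I_n -> 'I_D.+1) (E : 'I_D.+1 -> 'M[C]_n)
  (Y : {set 'I_n}) (dstar : 'I_D.+1) (t : nat) :
  (3 <= D)%N ->
  sym_assoc_scheme rel ->
  prim_idems rel E ->
  metric rel ->
  cometric E ->
  ~ ordinary_cycle rel ->
  (1 < #|Y| < n)%N ->
  dual_degree_is E Y dstar ->
  (t <= D)%N ->
  (forall (l : 'I_D.+1) x, x \in Y -> rel_codesign rel x t (Amx C rel l *m chi C Y)) ->
  (forall x, x \in Y -> forall (W : {vspace 'cV[C]_n}) (r rs : 'I_D.+1),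
     irr_Tmodule rel E x W -> r_is rel x W r -> rstar_is E W rs ->
     (1 <= rs <= dstar)%N -> (r <= rs)%N) ->
  [\/ (forall x y, rel x y = inord 1 -> (x \in Y) != (y \in Y)),
      antipodal_double_cover rel /\
        (exists x y, Y = [set x; y] /\ rel x y = ord_max)
    | (t.+1 <= dstar)%N].
Proof.
move=> Dgt2 sch primE met comet ncycle /andP[Y_gt1 Y_ltn] [[nz_d nz_chi] min_d] _ cod thin.
have [|le_dt] := ltnP t dstar; first by constructor 3.
have [z0 nz_z0] : exists z, \sum_(y in Y) E dstar z y != 0.
  have /matrix0Pn[z [k nz_zk]] := nz_chi.
  by exists z; rewrite -mul_chi -(ord1 k).
have design (j : 'I_D.+1) : j != ord0 -> (j < dstar)%N -> forall z, \sum_(y in Y) E j z y = 0.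
  move=> nz_j lt_j z; rewrite -mul_chi; have [->|nz] := eqVneq (E j *m chi C Y) 0.
    by rewrite mxE.
  by case: (min_d j lt_j).
have Dgt0 : (0 < D)%N by apply: leq_trans Dgt2.
have par x y : x \in Y -> y \in Y -> parallel E dstar x y.
  (* The multiplier is nonzero because [E dstar *m chi C Y] is; so any two columns indexed by [Y]
     are proportional, and comparing their entries at both points gives [parallel]. *)
  have prop u : u \in Y -> exists2 c, c != 0 &
      forall z, \sum_(y in Y) E dstar z y = c * E dstar z u.
    move=> Yu; have [c cE] :=
      codesign_proportional Dgt0 sch primE met comet (thin u Yu) (fun l => cod l u Yu) le_dt.
    exists c => [|z]; last by rewrite -mul_chi cE.
    by apply: contraNneq nz_z0 => c0; rewrite -mul_chi cE c0 mul0r.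
  move=> /prop[a nza aE] /prop[b nzb bE].
  have ab z : a * E dstar z x = b * E dstar z y by rewrite -aE -bE.
  rewrite /parallel; apply/eqP/(mulfI nza).
  have := ab y; rewrite (E_sym sch primE _ y x) (E_diag sch primE _ y x) => aby.
  by rewrite [LHS]mulrA aby mulrAC -ab; ring.
have delta_gt1 : (1 < dstar)%N.
  by apply: (dual_degree_gt1 Dgt2 sch primE comet nz_d Y_gt1 _ par); exists z0.
have [near|far] := boolP [exists x in Y, exists y in Y, (x != y) && (rel x y < D)%N].
  case/exists_inP: near => x Yx /exists_inP[y Yy /andP[ne_xy lt_xyD]].
  case: (parallel_bipartite_or_valency2 Dgt2 sch primE met nz_d ne_xy lt_xyD (par x y Yx Yy)).
    move=> alt; constructor 1; apply: (alternating_half Dgt2 sch primE nz_d Y_gt1 design Y_ltn _ alt).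
    exact: (E_alternating_last Dgt2 sch primE met comet nz_d alt).
  by move=> val2; case: ncycle; apply: valency2_cycle val2; first exact: ltnW.
have {}far x y : x \in Y -> y \in Y -> x != y -> rel x y = D :> nat.
  move=> Yx Yy ne_xy; apply/eqP; rewrite eqn_leq -ltnS ltn_ord leqNgt.
  apply: contra far => lt_xyD; apply/exists_inP; exists x => //.
  by apply/exists_inP; exists y; rewrite ?ne_xy.
constructor 2; apply: (antipodal_pair Dgt2 sch primE comet design delta_gt1 far).
apply/eqP; rewrite eqn_leq Y_gt1 andbT.
exact: (far_card_le2 Dgt2 sch primE met comet nz_d design delta_gt1 par far).
Qed.
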